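(* Every finite simple graph $G$ of order $n\ge 5$ satisfies $$\mathcal E(G)\ \ge\ r(G)+\bar d(G)-1.$$
   Context: For a finite simple graph $G$ with $n$ vertices and $m$ edges, let $A(G)$ be its adjacency matrix with eigenvalues $\lambda_1\ge\cdots\ge\lambda_n$ (counted with multiplicity). The energy is $\mathcal E(G)=\sum_{i=1}^n|\lambda_i|$, $r(G)=\operatorname{rank}A(G)$ (rank over $\mathbb R$), and $\bar d(G)=2m/n$ is the average degree. The order of $G$ is its number of vertices. *)

(* Defs.v *)
From HB Require Import structures.
From mathcomp Require Import all_boot all_order all_algebra.
From mathcomp Require Import reals.
From mathcomp.real_closed Require Import polyrcf complex.

Set Implicit Arguments.
Unset Strict Implicit.
Unset Printing Implicit Defensive.

Import Order.TTheory GRing.Theory Num.Theory.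

Local Open Scope ring_scope.

Record sgraph := SGraph {
  vertex :> finType;
  adj : rel vertex;
  adj_sym : symmetric adj;
  adj_irrefl : irreflexive adj
}.

Definition edges (G : sgraph) : {set {set G}} :=
  [set [set p.1; p.2] | p : G * G & adj p.1 p.2].

(* The enumeration [enum_val] of the vertices fixes the order of the rows and
   columns; another order gives a permutation-similar matrix. *)
Definition adjmx (R : nzRingType) (G : sgraph) : 'M[R]_#|G| :=
  \matrix_(i, j) (adj (enum_val i) (enum_val j))%:R.

(* [mup x p] is the multiplicity of [x] as a root of [p], and [rootsR p] is the
   increasing list of the distinct real roots of [p]. For a symmetric matrix,
   the algebraic multiplicities used here equal the geometric ones, and no
   eigenvalue is missed (see [size_spectrum] and [char_poly_spectrum]). *)
Definition spectrum (R : rcfType) n (A : 'M[R]_n) : seq R :=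
  rev (flatten [seq nseq (mup x (char_poly A)) x | x <- rootsR (char_poly A)]).

Definition energy (R : rcfType) (G : sgraph) : R :=
  \sum_(x <- spectrum (adjmx R G)) `|x|.

Definition avg_degree (R : rcfType) (G : sgraph) : R :=
  (2 * #|edges G|)%:R / #|G|%:R.

Lemma adjmx_sym (R : nzRingType) (G : sgraph) : (adjmx R G)^T = adjmx R G.
Proof. by apply/matrixP => i j; rewrite !mxE adj_sym. Qed.

Lemma sorted_spectrum (R : rcfType) n (A : 'M[R]_n) :
  sorted >=%R (spectrum A).
Proof.
rewrite /spectrum rev_sorted; have : sorted <%R (rootsR (char_poly A)).
  exact: sorted_roots.
move: (rootsR _) => s; rewrite lt_sorted_pairwise.
rewrite (_ : sorted _ _ = sorted <=%R (flatten [seq nseq (mup x (char_poly A)) x | x <- s])) //.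
rewrite le_sorted_pairwise; elim: s => //= x s IHs /andP[/allP lex /IHs Ps].
rewrite pairwise_cat Ps andbT; apply/andP; split.
  apply/allrelP => y z /nseqP[-> _] /flattenP[_ /mapP[t ts ->]] /nseqP[-> _].
  exact/ltW/lex.
by elim: (mup x _) => //= k ->; rewrite andbT; apply/allP => y /nseqP[->].
Qed.

Lemma char_poly_conj (F : fieldType) n (P D : 'M[F]_n) : P \in unitmx ->
  char_poly (invmx P *m D *m P) = char_poly D.
Proof.
move=> uP; rewrite /char_poly /char_poly_mx !map_mxM /=.
have eP : map_mx polyC (invmx P) *m map_mx polyC P = 1%:M.
  by rewrite -map_mxM mulVmx // map_mx1.
rewrite -[X in X - _]mulmx1 -eP mulmxA -scalar_mxC -mulmxBl -mulmxBr.
by rewrite !det_mulmx mulrAC -det_mulmx eP det1 mul1r.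
Qed.

Lemma split_char_poly (R : rcfType) n (A : 'M[R]_n) : A^T = A ->
  exists s : seq R, char_poly A = \prod_(x <- s) ('X - x%:P).
Proof.
move=> symA; pose B : 'M[R[i]]_n := map_mx (real_complex R) A.
have hB : B \is hermsymmx.
  apply: realsym_hermsym.
    apply/is_hermitianmxP; rewrite expr0 scale1r.
    by apply/matrixP=> i j; rewrite !mxE -{1}symA mxE.
  by apply/mxOverP => i j; rewrite mxE; apply/complex_realP; exists (A i j).
have /mxOverP rd := hermitian_spectral_diag_real hB.
have /orthomx_spectralP eB := hermitian_normalmx hB.
exists [seq complex.Re (spectral_diag B 0 i) | i <- enum 'I_n].
apply: (map_poly_inj (real_complex R)).
rewrite map_char_poly -/B rmorph_prod big_map big_enum /=.
have -> : char_poly B = char_poly (diag_mx (spectral_diag B)).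
  have uP : spectralmx B \in unitmx by exact: spectral_unit.
  rewrite [in LHS]eB; exact: char_poly_conj.
rewrite char_poly_trig ?diag_mx_is_trig //; apply: eq_bigr => i _.
by rewrite map_polyXsubC mxE eqxx mulr1n /= RRe_real.
Qed.

Lemma char_poly_spectrum (R : rcfType) n (A : 'M[R]_n) : A^T = A ->
  char_poly A = \prod_(x <- spectrum A) ('X - x%:P).
Proof.
move=> /split_char_poly[s eA]; rewrite {1}eA; apply: perm_big.
have p0 : char_poly A != 0 by rewrite monic_neq0 ?char_poly_monic.
rewrite perm_sym /spectrum perm_rev; apply/allP => x _ /=.
rewrite count_flatten -map_comp -mu_prod_XsubC -eA sumnE big_map.
have Ur : uniq (rootsR (char_poly A)).
  exact/lt_sorted_uniq/sorted_roots.
under eq_bigr do rewrite /= count_nseq /=.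
have [xr|xr] := boolP (x \in rootsR (char_poly A)).
  rewrite (bigD1_seq x) //= eqxx mul1n big1 ?addn0 // => y yx.
  by rewrite (negPf yx) mul0n.
rewrite big_seq big1 => [|y yr].
  apply/eqP/esym; apply: mupNroot; apply: contra xr => rx.
  by rewrite -(roots_on_rootsR p0) in_itv.
by case: eqP yr xr => [->->|].
Qed.

Lemma size_spectrum (R : rcfType) n (A : 'M[R]_n) : A^T = A ->
  size (spectrum A) = n.
Proof.
move=> /char_poly_spectrum/(congr1 (fun p : {poly R} => size p)).
by rewrite size_char_poly size_prod_XsubC => -[].
Qed.

(* Main.v *)
(* Let l be the largest eigenvalue, d the average degree, r the rank.  Then
   l >= d, the eigenvalues have sum 0 and sum of squares n d, and the product of
   the nonzero ones is a nonzero integer.  A second-order strengthening of AM-GM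
   bounds this product by exp (sum (|x| - 1)) times a factor that decreases with
   the l2-distance z of the |x| to 1, while the sum of squares forces z to be
   large when the energy is less than r + d - 1.  This is contradictory as soon
   as there are two positive eigenvalues besides l, or one of them together with
   the eigenvalue 0, or one that is at least 1.

   If l is the only positive eigenvalue, the graph has no induced 2K2, P4 or paw,
   so it is complete multipartite up to isolated vertices: r is at most the
   clique number k, and the energy, at least 2 l, is at least d + (k - 1).

   Otherwise A is nonsingular with two positive eigenvalues, the second being
   less than 1.  The vertices outside an induced P4 or paw are then so restricted
   that det A is divisible by n - 3, resp. by t and n - 2 - t for some t, and the
   better lower bound on the product closes the case. *)

Require Import Defs.
From mathcomp Require Import all_boot all_order all_algebra.
From mathcomp Require Import all_classical.
From mathcomp Require Import reals topology normedtype derive realfun exp sequences.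
From mathcomp.real_closed Require Import complex.
From mathcomp Require Import ring lra zify.

Set Implicit Arguments.
Unset Strict Implicit.
Unset Printing Implicit Defensive.

Import Order.TTheory GRing.Theory Num.Theory numFieldNormedType.Exports.

Local Open Scope ring_scope.

(** * Exponential inequalities *)

Section Calculus.
Variable R : realType.
Implicit Types (a b x y z t : R).

(** For average degree at most 1, plain AM-GM suffices. For [d > 1] the excess [d - 1] comes from
    playing the two inequalities of [pool_master] against each other: the product one bounds [z]
    from above, the one from the sum of squares bounds it from below. They involve only a few real
    parameters, whatever the order of the graph, and once [d] and [a] are eliminated two variables
    remain. The obstacle is the nonsingular case with a single positive eigenvalue [p] besides [l].
    With a product only known to be at least 1, the two inequalities are then consistent: [p = 1],
    [l = d = 3], [z = 2] and a small [e] satisfy both. More input is needed: a larger divisor of the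
    determinant, or, for [p >= 1], a second pooling of the negative eigenvalues around 2/3. The
    second pooling helps because the mean of their absolute values is then less than 1, whereas the
    bound around 1 is sharp only if all but one of them equal 1. *)

Lemma nondecreasing_of_derive (f df : R -> R) a b : a <= b ->
  (forall x, a <= x <= b -> is_derive x 1 f (df x)) ->
  (forall x, a < x < b -> 0 <= df x) -> f a <= f b.
Proof.
move=> ab fd df0.
have [ab'|] := ltP a b; last by move=> ba; have -> : a = b by apply/le_anti; rewrite ab.
have [||c] := @MVT R f df a b ab'.
- by move=> x; rewrite in_itv /= => /andP[ax xb]; apply: fd; rewrite !ltW.
- apply: derivable_within_continuous => x; rewrite in_itv /= => /fd.
  by move=> [].
rewrite in_itv /= => /df0 c0 E.
by rewrite -subr_ge0 E mulr_ge0// subr_ge0.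
Qed.

(** The cubic satisfies [p + p' = - x^3 / 6], so [expR x * p.[x]] decreases from its value 1 at
    0. *)
Lemma expRN_ge3 t : 0 <= t ->
  1 - t + t ^+ 2 / 2 - t ^+ 3 / 6 <= expR (- t).
Proof.
move=> t0.
pose p : {poly R} := 1 - 'X + 2^-1 *: 'X^2 - 6^-1 *: 'X^3.
have pE x : p.[x] = 1 - x + x ^+ 2 / 2 - x ^+ 3 / 6.
  by rewrite /p !hornerE /=; field.
have p'E x : (deriv p).[x] = - 1 + x - x ^+ 2 / 2.
  by rewrite /p !poly.derivE !hornerE /=; field.
pose f : R -> R := - ((expR : R -> R) * (horner p : R -> R)).
pose df x : R := expR x * x ^+ 3 / 6.
have fd x : is_derive x 1 f (df x).
  by apply: is_derive_eq; rewrite p'E pE /df /GRing.scale /=; field.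
have : f 0 <= f t.
  apply: (@nondecreasing_of_derive f df) => // y /andP[x0 _]; rewrite /df.
  by rewrite divr_ge0 ?mulr_ge0 ?expR_ge0 ?exprn_ge0 ?ltW.
have fE x : f x = - (expR x * p.[x]) by [].
rewrite !fE expR0 !pE lerN2 => H.
rewrite expRN -[leRHS]div1r ler_pdivlMr ?expR_gt0// mulrC.
apply: le_trans H _; lra.
Qed.

Lemma expR_ge_series n t : 0 <= t ->
  \sum_(0 <= i < n) t ^+ i / i`!%:R <= expR t.
Proof.
move=> t0.
have E : \sum_(0 <= i < n) t ^+ i / i`!%:R = series (exp_coeff t) n.
  by rewrite /series /=; apply: eq_bigr.
rewrite E; apply: nondecreasing_cvgn_le; last exact: is_cvg_series_exp_coeff.
by apply: nondecreasing_series => i _ _; exact: exp_coeff_ge0.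
Qed.

(** The difference [f k] of the two sides vanishes at 0 and at [x]. Its derivative is [z] times a
    decreasing factor, which is nonnegative for [z <= 0] as [2 * k <= 1]; so [f k] decreases up to
    0, and on [[0, x]] it can only rise and then fall back to 0. *)
Lemma ln1D_le_quad k x z : 0 < x -> x - k * x ^+ 2 = ln (1 + x) ->
  -1 < z -> z <= x -> ln (1 + z) <= z - k * z ^+ 2.
Proof.
move=> x0 kE z1 zx.
pose p (c : R) : {poly R} := 'X - c *: 'X^2.
pose q : {poly R} := 1 + 'X.
have pE c y : (p c).[y] = y - c * y ^+ 2 by rewrite /p !hornerE /=; ring.
have p'E c y : (deriv (p c)).[y] = 1 - c * (2 * y) by rewrite /p !poly.derivE !hornerE /=; ring.
have qE y : q.[y] = 1 + y by rewrite /q !hornerE.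
have q'E y : (deriv q).[y] = 1 by rewrite /q !poly.derivE !hornerE /=; ring.
pose f c : R -> R := (horner (p c) : R -> R) - ((@ln R \o horner q) : R -> R).
pose df (c y : R) : R := y * ((1 + y)^-1 - 2 * c).
have fE c y : f c y = y - c * y ^+ 2 - ln (1 + y).
  by rewrite -[f c y]/((p c).[y] - ln q.[y]) pE qE.
have fd c y : -1 < y -> is_derive y 1 (f c) (df c y).
  move=> y1; have q0 : 0 < q.[y] by rewrite qE; lra.
  have D := is_derive1_ln q0.
  apply: is_derive_eq; rewrite p'E q'E qE /df /GRing.scale /=. field.
  by apply: lt0r_neq0; lra.
have f0 c : f c 0 = 0 by rewrite fE expr0n /= mulr0 subr0 addr0 ln1 subr0.
have fx : f k x = 0 by rewrite fE kE subrr.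
suff : 0 <= f k z by rewrite fE subr_ge0.
(* This amounts to [x - x^2 / 2 <= ln (1 + x)]. *)
have k2 : 2 * k <= 1.
  have : f (1/2) x <= f (1/2) 0.
    rewrite -lerN2; have := @nondecreasing_of_derive (- f (1/2)) (fun y => - df (1/2) y) 0 x (ltW x0).
    rewrite !fctE; apply=> y /andP[y0 yx].
      by have D := @fd (1/2) y; apply: is_deriveN; apply: D; lra.
    rewrite /df oppr_ge0 pmulr_rle0// subr_le0 invf_ple ?posrE; lra.
  rewrite f0 fE -kE => H.
  have {H} : (k - 1/2) * x ^+ 2 <= 0 by lra.
  by rewrite pmulr_lle0 ?exprn_gt0//; lra.
have [z0|z0] := leP z 0.
  rewrite -(f0 k) -lerN2.
  have := @nondecreasing_of_derive (- f k) (fun y => - df k y) z 0 z0.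
  rewrite !fctE; apply=> y /andP[y0 yx].
    by have D := @fd k y; apply: is_deriveN; apply: D; lra.
  rewrite /df -mulNr mulr_ge0//; first lra.
  rewrite subr_ge0; apply: le_trans k2 _; rewrite invf_ge1; lra.
have [H|H] := leP (2 * k) (1 + z)^-1.
  rewrite -(f0 k); apply: (@nondecreasing_of_derive _ (df k)); first exact: ltW.
    by move=> y /andP[y0 yx]; apply: fd; lra.
  move=> y /andP[y0 yz]; rewrite /df mulr_ge0//; first lra.
  rewrite subr_ge0; apply: le_trans H _; rewrite lef_pV2 ?posrE; lra.
rewrite -fx -lerN2.
have := @nondecreasing_of_derive (- f k) (fun y => - df k y) z x zx.
rewrite !fctE; apply=> y /andP[y0 yx].
  by have D := @fd k y; apply: is_deriveN; apply: D; lra.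
rewrite /df -mulrN mulr_ge0//; first lra.
rewrite opprB subr_ge0; apply: le_trans (ltW H).
rewrite lef_pV2 ?posrE; lra.
Qed.

(* Taylor's formula with the quadratic term calibrated at the largest possible
   value of a single [z], namely the l2 norm of the whole family. *)
Lemma prod1D_le_expR (s : seq R) x : {in s, forall z, -1 < z} ->
  0 <= x -> \sum_(z <- s) z ^+ 2 = x ^+ 2 ->
  (\prod_(z <- s) (1 + z)) * expR x <= expR (\sum_(z <- s) z) * (1 + x).
Proof.
move=> s1 x0 sx.
have [xe|xn0] := eqVneq x 0.
  rewrite xe expR0 mulr1 addr0 mulr1.
  have s0 z : z \in s -> z = 0.
    move=> zs; move: sx; rewrite xe expr0n /= => /eqP.
    rewrite psumr_eq0 => [/allP/(_ _ zs)|y _]; last exact: sqr_ge0.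
    by rewrite /= sqrf_eq0 => /eqP.
  rewrite big_seq big1 ?expR_ge1 //; last by move=> z /s0 ->; rewrite addr0.
  by rewrite big_seq big1 // expR0.
have {xn0 x0} x0 : 0 < x by rewrite lt_neqAle eq_sym xn0.
pose k := (x - ln (1 + x)) / x ^+ 2.
have kE : x - k * x ^+ 2 = ln (1 + x).
  by rewrite /k; field; rewrite gt_eqF.
have zx z : z \in s -> z <= x.
  move=> zs; apply: le_trans (ler_norm _) _.
  rewrite -(@ler_pXn2r _ 2) ?nnegrE ?normr_ge0 ?(ltW x0)// real_normK ?num_real// -sx (big_rem z)//=.
  by rewrite lerDl big_seq sumr_ge0// => y _; exact: sqr_ge0.
have -> : expR x = expR (k * x ^+ 2) * (1 + x).
  rewrite -{1}(@lnK _ (1 + x)) ?posrE; last by lra.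
  by rewrite -kE -expRD; congr expR; ring.
rewrite mulrA ler_pM2r; last by lra.
rewrite -sx mulr_sumr !expR_sum -big_split /=.
rewrite big_seq [leRHS]big_seq; apply: ler_prod => z zs.
have z1 := s1 _ zs; apply/andP; split.
  by rewrite mulr_ge0 ?expR_ge0//; lra.
rewrite -{1}(@lnK _ (1 + z)) ?posrE; last by lra.
by rewrite -expRD ler_expR; have := ln1D_le_quad x0 kE z1 (zx _ zs); lra.
Qed.

End Calculus.

(** * Polynomials against the exponential *)

Section ExponentialBounds.
Variable R : realType.
Implicit Types (a b p x y z t : R).

Lemma expR_ge3 t : 0 <= t -> 1 + t + t ^+ 2 / 2 + t ^+ 3 / 6 <= expR t.
Proof.
move=> /(expR_ge_series 4); rewrite !big_nat_recr //= ?big_geq // ?big_nil.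
by rewrite !factS fact0 /= ; apply: le_trans; rewrite le_eqVlt; apply/orP; left; apply/eqP; field.
Qed.

Lemma expR_ge4 t : 0 <= t ->
  1 + t + t ^+ 2 / 2 + t ^+ 3 / 6 + t ^+ 4 / 24 <= expR t.
Proof.
move=> /(expR_ge_series 5); rewrite !big_nat_recr //= ?big_geq // ?big_nil.
by rewrite !factS fact0 /= ; apply: le_trans; rewrite le_eqVlt; apply/orP; left; apply/eqP; field.
Qed.

Lemma expR_ge6 t : 0 <= t ->
  1 + t + t ^+ 2 / 2 + t ^+ 3 / 6 + t ^+ 4 / 24 + t ^+ 5 / 120 + t ^+ 6 / 720 <= expR t.
Proof.
move=> /(expR_ge_series 7); rewrite !big_nat_recr //= ?big_geq // ?big_nil.
by rewrite !factS fact0 /= ; apply: le_trans; rewrite le_eqVlt; apply/orP; left; apply/eqP; field.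
Qed.

(** The bounds on [(1 + z) * (z^2 + c)] for [c = 3, 2, 1] are nodes of an interpolation:
    intermediate [c] are reached by convex combination, and for [c >= 3] one adds
    [(c - 3) * (1 + z) <= (c - 3) * expR z]. The quotient by [expR z] is largest at 0 for [c = 3],
    at 2 for [c = 2] and at [1 + sqrt 2] for [c = 1]; 5/2 and 43/20 are slightly above the last two
    maxima. *)
Lemma cubic3_le_expR z : 0 <= z -> (1 + z) * (z ^+ 2 + 3) <= 3 * expR z.
Proof.
move=> z0; have := expR_ge4 z0.
have : 0 <= (z * (z - 2)) ^+ 2 by exact: sqr_ge0.
by lra.
Qed.

Lemma cubic2_le_expR z : 0 <= z -> (1 + z) * (z ^+ 2 + 2) <= 5 / 2 * expR z.
Proof.
move=> z0; have := expR_ge6 z0.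
suff : 0 <= 1/2 + z/2 + z ^+ 2 / 4 - 7/12 * z ^+ 3 + 5/48 * z ^+ 4 + z ^+ 5 / 48 + z ^+ 6 / 288 by lra.
have : 0 <= z ^+ 2 * ((z - 2) ^+ 2 * (z ^+ 2 + 10 * z + 66)).
  by rewrite mulr_ge0 ?sqr_ge0// mulr_ge0 ?sqr_ge0//; nra.
suff : 0 <= 1/2 + z/2 - 2/3 * z ^+ 2 + 7/36 * z ^+ 3 by lra.
by have : 0 <= z * (z - 18/10) ^+ 2 by [rewrite mulr_ge0 ?sqr_ge0]; nra.
Qed.

Lemma cubic1_le_expR z : 0 <= z -> (1 + z) * (z ^+ 2 + 1) <= 43 / 20 * expR z.
Proof.
move=> z0; have := expR_ge6 z0.
have : 0 <= z ^+ 2 * ((5 * z - 12) ^+ 2 * (z ^+ 2 + 108/10 * z + 76)).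
  by rewrite mulr_ge0 ?sqr_ge0// mulr_ge0 ?sqr_ge0//; nra.
have : 0 <= z * (z - 5/2) ^+ 2 by rewrite mulr_ge0 ?sqr_ge0.
nra.
Qed.

Lemma expRN1_ge : 73/200 <= expR (-1 : R).
Proof.
have /expRN_ge3 : (0 : R) <= 1/2 by lra.
have -> : expR (-1 : R) = expR (- (1/2)) ^+ 2 by rewrite -expRM_natl; congr expR; field.
set e := expR _ => e2.
have {e2} : 29/48 <= e by lra.
by move=> e2; nra.
Qed.

Lemma expR_pred_ge p : p <= expR (p - 1).
Proof. by have := expR_ge1Dx (p - 1); lra. Qed.

Lemma expR_pred_ge3 p : p <= 1 ->
  1 - (1 - p) + (1 - p) ^+ 2 / 2 - (1 - p) ^+ 3 / 6 <= expR (p - 1).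
Proof. by move=> p1; have := @expRN_ge3 R (1 - p); rewrite opprB; apply; lra. Qed.

(** What [no_two_positive] reduces to once [d] and [a] are eliminated; [x] is the mean of [p1] and
    [p2]. *)
Lemma exp_bound_two x z : 0 <= x -> 0 <= z ->
  x * (1 + z) * (z ^+ 2 + 2 + 2 * x ^+ 2) <= 4 * expR (z + 2 * (x - 1)).
Proof.
move=> x0 z0; rewrite expRD mulrCA.
have c3 := cubic3_le_expR z0; have c2 := cubic2_le_expR z0.
have e1 := expR_ge1Dx z.
have ez := expR_ge0 z; move: (expR z) c3 c2 e1 ez => e c3 c2 e1 ez.
have q : x <= 1 -> (1 - (1 - x) + (1 - x) ^+ 2 / 2 - (1 - x) ^+ 3 / 6) ^+ 2 <= expR (2 * (x - 1)).
  move=> x1; rewrite (expRM_natl 2).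
  rewrite ler_pXn2r ?nnegrE ?expR_ge0 ?expR_pred_ge3//.
  have : 0 <= x * (1 - x) ^+ 2 by rewrite mulr_ge0 ?sqr_ge0.
  nra.
have [x2|x2] := leP (x ^+ 2) (1/2).
  have x1 : x <= 3/4 by nra.
  have {q} : x * (5/2 + x ^+ 2) <= 4 * expR (2 * (x - 1)).
    apply: (@le_trans _ _ (4 * (1 - (1 - x) + (1 - x) ^+ 2 / 2 - (1 - x) ^+ 3 / 6) ^+ 2)); last first.
      by have := q; lra.
    clear -x0 x1; nra.
  move: (expR _) => f H.
  have : (1 + z) * (z ^+ 2 + 2 + 2 * x ^+ 2) <= (5/2 + x ^+ 2) * e.
    have : 0 <= x ^+ 2 * (3 * e - (1 + z) * (z ^+ 2 + 3)).
      by rewrite mulr_ge0 ?sqr_ge0// subr_ge0.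
    have : 0 <= (1/2 - x ^+ 2) * (5/2 * e - (1 + z) * (z ^+ 2 + 2)).
      by rewrite mulr_ge0 ?subr_ge0.
    by lra.
  move=> H2.
  have : x * ((1 + z) * (z ^+ 2 + 2 + 2 * x ^+ 2)) <= x * ((5/2 + x ^+ 2) * e) by rewrite ler_wpM2l.
  have : e * (x * (5/2 + x ^+ 2)) <= e * (4 * f) by rewrite ler_wpM2l.
  by lra.
have {q} : x * (1 + x ^+ 2) <= 2 * expR (2 * (x - 1)).
  have [x1|x1] := leP x 1.
    apply: (@le_trans _ _ (2 * (1 - (1 - x) + (1 - x) ^+ 2 / 2 - (1 - x) ^+ 3 / 6) ^+ 2)); last first.
      by have := q x1; lra.
    clear -x0 x1; set h := 1 - x; have -> : x = 1 - h by rewrite /h; ring.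
    have h0 : 0 <= h by rewrite /h; lra.
    have h1 : h <= 1 by rewrite /h; lra.
    suff : 0 <= h ^+ 2 * (1 - 5/3 * h + 7/6 * h ^+ 2 - h ^+ 3 / 3 + h ^+ 4 / 18) by lra.
    rewrite mulr_ge0 ?sqr_ge0//.
    have : 0 <= h ^+ 2 * (1 - h) by rewrite mulr_ge0 ?sqr_ge0// subr_ge0.
    have : 0 <= h ^+ 4 by rewrite exprn_ge0.
    nra.
  have t0 : 0 <= 2 * (x - 1) by lra.
  have := expR_ge3 t0; move: (expR _) => f H; have h0 : 0 <= x - 1 by lra.
  have h2 : 0 <= (x - 1) ^+ 2 by rewrite sqr_ge0.
  have h3 : 0 <= (x - 1) ^+ 3 by rewrite exprn_ge0.
  by lra.
move: (expR _) => f H.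
have : (1 + z) * (z ^+ 2 + 2 + 2 * x ^+ 2) <= (2 + 2 * x ^+ 2) * e.
  have : 0 <= (x ^+ 2 - 1/2) * (e - (1 + z)) by rewrite mulr_ge0 ?subr_ge0//; lra.
  by lra.
move=> H2.
have : x * ((1 + z) * (z ^+ 2 + 2 + 2 * x ^+ 2)) <= x * ((2 + 2 * x ^+ 2) * e) by rewrite ler_wpM2l.
have : e * (x * (1 + x ^+ 2)) <= e * (2 * f) by rewrite ler_wpM2l.
by lra.
Qed.

End ExponentialBounds.

(** * Two positive eigenvalues besides the largest, or one together with the eigenvalue 0 *)

Section Contradictions.
Variable R : realType.
Implicit Types (a b p x y z t d : R).

(** This eliminates [a]: from [2 * p * (d - 1) <= y + a^2] it gives
    [2 * p * (d + a) <= expR a * (2 * p + y)], and the factor [expR a] cancels against the one in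
    the product inequality. *)
Lemma expR_absorb a p y : 0 <= a -> 0 < p -> (1 - p) ^+ 2 <= y ->
  2 * p * (1 + a) + y + a ^+ 2 <= expR a * (2 * p + y).
Proof.
move=> a0 p0 hy; have := expR_ge3 a0; set e := expR a => he.
have y0 : 0 <= y by apply: le_trans hy; exact: sqr_ge0.
apply: (@le_trans _ _ ((1 + a + a ^+ 2 / 2 + a ^+ 3 / 6) * (2 * p + y))); last first.
  by rewrite ler_wpM2r//; lra.
suff : 0 <= a * (y * (1 + a / 2 + a ^+ 2 / 6) + a * (p - 1) + a ^+ 2 * p / 3) by lra.
rewrite mulr_ge0//.
apply: (@le_trans _ _ ((1 - p) ^+ 2 * (1 + a / 2 + a ^+ 2 / 6) + a * (p - 1) + a ^+ 2 * p / 3)); last first.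
  rewrite !lerD2r ler_wpM2r//; nra.
have : 0 <= (1 - p - a / 2 * (1 - (1 - p) / 2)) ^+ 2 by exact: sqr_ge0.
have : 0 <= a ^+ 2 * (5/48 * (1 - p - 2/5) ^+ 2 + 1/15).
  by rewrite mulr_ge0 ?sqr_ge0//; have := sqr_ge0 (1 - p - 2/5); lra.
by lra.
Qed.

Lemma expR_absorb_large a p y : 0 <= a -> 0 < p -> 0 <= y -> 1 <= p + y / 2 ->
  2 * p * (1 + a) + y + a ^+ 2 <= expR a * (2 * p + y).
Proof.
move=> a0 p0 y0 hy; have := expR_ge3 a0; set e := expR a => he.
apply: (@le_trans _ _ ((1 + a + a ^+ 2 / 2) * (2 * p + y))).
  have : 0 <= a * y by rewrite mulr_ge0.
  have : 0 <= a ^+ 2 * (p + y / 2 - 1) by rewrite mulr_ge0 ?sqr_ge0// subr_ge0.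
  by lra.
rewrite ler_wpM2r//; first lra.
have : 0 <= a ^+ 3 by rewrite exprn_ge0.
by lra.
Qed.

(* Here and below, [a = l - d], [e] measures by how much the energy is too small,
   [p1], [p2], [p] are the other positive eigenvalues, and [z] is the l2-distance
   to 1 of the absolute values of the remaining ones. *)
Lemma no_two_positive a d e p1 p2 z : 0 <= a -> 0 < e -> 0 < p1 -> 0 < p2 -> 0 <= z ->
  expR (z + a + e + (p1 + p2) - 2) <= (d + a) * (p1 * p2) * (1 + z) ->
  2 * (p1 + p2) * (d - 1) <= z ^+ 2 + (1 - p1) ^+ 2 + (1 - p2) ^+ 2 + a ^+ 2 -> False.
Proof.
move=> a0 e0 p10 p20 z0 M1 M2.
set P := p1 + p2 in M1 M2; have P0 : 0 < P by rewrite addr_gt0.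
pose m := p1 * p2; have m0 : 0 < m by rewrite mulr_gt0.
have m4 : 4 * m <= P ^+ 2.
  by have : 0 <= (p1 - p2) ^+ 2 by [exact: sqr_ge0]; rewrite /m /P; lra.
pose y := z ^+ 2 + (1 - p1) ^+ 2 + (1 - p2) ^+ 2.
have yE : 2 * P + y = z ^+ 2 + 2 + P ^+ 2 - 2 * m by rewrite /y /P /m; ring.
have y0 : 0 <= y by rewrite !addr_ge0 ?sqr_ge0.
have yP : 1 <= P + y / 2.
  have := sqr_ge0 z; have := sqr_ge0 p1; have := sqr_ge0 p2; rewrite /y /P; lra.
have := expR_absorb_large a0 P0 y0 yP; set ea := expR a => H1.
have ea0 : 0 < ea by exact: expR_gt0.
have H2 : 2 * P * (d + a) <= ea * (2 * P + y) by rewrite /y in H1 *; lra.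
have H3 : ea * expR (z + 2 * (P / 2 - 1)) < (d + a) * m * (1 + z).
  apply: lt_le_trans M1; rewrite -expRD ltr_expR; lra.
have x0 : 0 <= P / 2 by lra.
have := exp_bound_two x0 z0; set f := expR _ in H3 * => H4.
have f0 : 0 < f by exact: expR_gt0.
have zm : 0 < m * (1 + z) by rewrite mulr_gt0//; lra.
have H5 : 2 * P * (d + a) * (m * (1 + z)) <= ea * (2 * P + y) * (m * (1 + z)) by rewrite ler_pM2r.
have H6 : 2 * P * (ea * f) < 2 * P * ((d + a) * m * (1 + z)) by rewrite ltr_pM2l//; lra.
have H7 : ea * (2 * P * f) < ea * ((2 * P + y) * (m * (1 + z))) by lra.
rewrite ltr_pM2l// yE in H7.
(* The left side increases with [m] as long as [4 * m <= P^2], so the worst case is [p1 = p2]. *)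
have H8 : m * (z ^+ 2 + 2 + P ^+ 2 - 2 * m) <= P ^+ 2 / 4 * (z ^+ 2 + 2 + P ^+ 2 / 2).
  have : 0 <= (P ^+ 2 / 4 - m) * (z ^+ 2 + 2 + P ^+ 2 / 2 - 2 * m).
    rewrite mulr_ge0//; first by lra.
    have := sqr_ge0 z; lra.
  by lra.
have H9 : m * (z ^+ 2 + 2 + P ^+ 2 - 2 * m) * (1 + z) <= P ^+ 2 / 4 * (z ^+ 2 + 2 + P ^+ 2 / 2) * (1 + z).
  by rewrite ler_pM2r//; lra.
have H10 : P / 2 * (P / 2 * (1 + z) * (z ^+ 2 + 2 + 2 * (P / 2) ^+ 2)) <= P / 2 * (4 * f) by rewrite ler_wpM2l.
by lra.
Qed.

Lemma exp_bound_singular p z : 0 < p -> 0 <= z ->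
  p * (1 + z) * (z ^+ 2 + 1 + p ^+ 2) <= (2 * p + 1) * expR (z + (p - 1)).
Proof.
move=> p0 z0; rewrite expRD.
have c3 := cubic3_le_expR z0; have c1 := cubic1_le_expR z0.
have e1 := expR_ge1Dx z.
have ez := expR_ge0 z; move: (expR z) c3 c1 e1 ez => e c3 c1 e1 ez.
have [p2|p2] := leP (p ^+ 2) 2.
  have H : p * (43/20 + 17/40 * p ^+ 2) <= (2 * p + 1) * expR (p - 1).
    have [p1|p1] := leP p 1.
      apply: (@le_trans _ _ ((2 * p + 1) * (1 - (1 - p) + (1 - p) ^+ 2 / 2 - (1 - p) ^+ 3 / 6))); last first.
        by rewrite ler_wpM2l ?expR_pred_ge3//; lra.
      clear -p1 p0; nra.
    have t0 : 0 <= p - 1 by lra.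
    have := expR_ge3 t0; move: (expR _) => f Hf.
    apply: (@le_trans _ _ ((2 * p + 1) * (1 + (p - 1) + (p - 1) ^+ 2 / 2 + (p - 1) ^+ 3 / 6))); last first.
      by rewrite ler_wpM2l//; lra.
    clear -p1 p0 p2; nra.
  move: (expR _) H => f H.
  have : (1 + z) * (z ^+ 2 + 1 + p ^+ 2) <= (43/20 + 17/40 * p ^+ 2) * e.
    have : 0 <= p ^+ 2 * (3 * e - (1 + z) * (z ^+ 2 + 3)) by rewrite mulr_ge0 ?sqr_ge0// subr_ge0.
    have : 0 <= (2 - p ^+ 2) * (43/20 * e - (1 + z) * (z ^+ 2 + 1)) by rewrite mulr_ge0 ?subr_ge0//; lra.
    by lra.
  move=> H2.
  have : p * ((1 + z) * (z ^+ 2 + 1 + p ^+ 2)) <= p * ((43/20 + 17/40 * p ^+ 2) * e) by rewrite ler_wpM2l// ltW.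
  have : e * (p * (43/20 + 17/40 * p ^+ 2)) <= e * ((2 * p + 1) * f) by rewrite ler_wpM2l.
  by lra.
have p1 : 1 <= p by nra.
have H : p * (1 + p ^+ 2) <= (2 * p + 1) * expR (p - 1).
  have t0 : 0 <= p - 1 by lra.
  have := expR_ge3 t0; move: (expR _) => f Hf.
  apply: (@le_trans _ _ ((2 * p + 1) * (1 + (p - 1) + (p - 1) ^+ 2 / 2 + (p - 1) ^+ 3 / 6))); last first.
    by rewrite ler_wpM2l//; lra.
  clear -p1 p0 p2; nra.
move: (expR _) H => f H.
have H2 : (1 + z) * (z ^+ 2 + 1 + p ^+ 2) <= (1 + p ^+ 2) * e.
  have : 0 <= (p ^+ 2 - 2) * (e - (1 + z)) by rewrite mulr_ge0 ?subr_ge0//; lra.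
  by lra.
have : p * ((1 + z) * (z ^+ 2 + 1 + p ^+ 2)) <= p * ((1 + p ^+ 2) * e) by rewrite ler_wpM2l// ltW.
have : e * (p * (1 + p ^+ 2)) <= e * ((2 * p + 1) * f) by rewrite ler_wpM2l.
by lra.
Qed.

(** The extra [d] in the last inequality is the contribution of a zero eigenvalue. The bounds [H1],
    [H2] and [H3'] treat the terms of degree 0, 1 and 2 in [1 + a + a^2 / 2 <= expR a]. *)
Lemma no_singular a d e p z : 0 <= a -> 0 < e -> 0 < p -> 0 <= z ->
  expR (z + a + e + p - 1) <= (d + a) * p * (1 + z) ->
  2 * p * (d - 1) + d <= z ^+ 2 + (1 - p) ^+ 2 + a ^+ 2 -> False.
Proof.
move=> a0 e0 p0 z0 M1 M2.
have H1 := exp_bound_singular p0 z0.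
have H2 : p * (1 + z) <= expR (z + (p - 1)).
  rewrite expRD mulrC ler_pM//; [lra|exact: ltW| |exact: expR_pred_ge].
  exact: expR_ge1Dx.
have H3' : 2 * p * (1 + z) <= (2 * p + 1) * expR (z + (p - 1)).
  rewrite expRD; have ez := expR_ge1Dx z.
  have : 2 * p <= (2 * p + 1) * expR (p - 1).
    have [p1|p1] := leP p (1/2); last by have := expR_pred_ge p; move: (expR _) => f Hf; nra.
    rewrite expRD; have := @expRN1_ge R; have := expR_ge1Dx p.
    move: (expR p) (expR _) => f g Hf Hg.
    apply: (@le_trans _ _ ((2 * p + 1) * ((1 + p) * (73/200)))); last first.
      by rewrite ler_wpM2l ?ler_pM//; lra.
    clear -p1 p0; nra.
  move: (expR z) (expR (p - 1)) ez => g f ez Hf.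
  have : (2 * p) * (1 + z) <= ((2 * p + 1) * f) * g.
    by rewrite ler_pM//; lra.
  by lra.
have H4 : expR a * expR (z + (p - 1)) < (d + a) * p * (1 + z).
  by apply: lt_le_trans M1; rewrite -expRD ltr_expR; lra.
have := expR_ge3 a0; set g := expR a in H4 * => Hg.
move: (expR (z + (p - 1))) H1 H2 H3' H4 => f H1 H2 H3' H4.
have f0 : 0 <= f.
  by apply: le_trans H2; rewrite mulr_ge0//; [exact: ltW|lra].
have Hg' : 1 + a + a ^+ 2 / 2 <= g by have : 0 <= a ^+ 3 by [rewrite exprn_ge0]; lra.
have H5 : (1 + a + a ^+ 2 / 2) * f <= g * f by rewrite ler_wpM2r.
have H6 : (2 * p + 1) * ((1 + a + a ^+ 2 / 2) * f) < (2 * p + 1) * ((d + a) * p * (1 + z)).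
  by rewrite ltr_pM2l; lra.
have H7 : (2 * p + 1) * (d + a) * (p * (1 + z)) <=
    (a * (2 * p + 1) + z ^+ 2 + 1 + p ^+ 2 + a ^+ 2) * (p * (1 + z)).
  rewrite ler_wpM2r ?mulr_ge0//; [exact: ltW|lra|lra].
have H8 : 0 <= a * (2 * p + 1) * (f - p * (1 + z)).
  by rewrite !mulr_ge0 ?subr_ge0//; lra.
have H9 : 0 <= a ^+ 2 * ((2 * p + 1) * f - 2 * p * (1 + z)).
  by rewrite mulr_ge0 ?sqr_ge0// subr_ge0.
by lra.
Qed.

End Contradictions.

(** * One other positive eigenvalue, and a product of absolute values at least 2 or 3 *)

Section DeterminantBounds.
Variable R : realType.
Implicit Types (a b p x y z t d : R).

Lemma expR_shift_ge p z : 73/200 * (expR z * expR p) <= expR (z + (p - 1)).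
Proof.
rewrite !expRD mulrA [leRHS]mulrC ler_pM2r ?mulr_gt0 ?expR_gt0//.
exact: expRN1_ge.
Qed.

Lemma exp_bound_det3 p z : 0 <= p -> 0 <= z ->
  (1 + z) * (z ^+ 2 + 1 + p ^+ 2) <= 6 * expR (z + (p - 1)).
Proof.
move=> p0 z0; have := expR_shift_ge p z; have c1 := cubic1_le_expR z0.
have := expR_ge3 p0; move: (expR z) (expR p) (expR (z + (p - 1))) c1 => g f e c1 Hf He.
have H : 1 + p ^+ 2 <= f.
  apply: le_trans Hf; have : 0 <= p * (p - 3/2) ^+ 2 by rewrite mulr_ge0 ?sqr_ge0.
  nra.
have z1 : 0 <= (1 + z) * (z ^+ 2 + 1) by rewrite mulr_ge0 ?addr_ge0 ?sqr_ge0//.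
have g0 : 0 <= g by lra.
have H2 : (1 + z) * (z ^+ 2 + 1) * (1 + p ^+ 2) <= 43/20 * g * f.
  by rewrite ler_pM// ?addr_ge0 ?sqr_ge0.
have H3 : 0 <= (1 + z) * (z ^+ 2 * p ^+ 2).
  by rewrite mulr_ge0 ?mulr_ge0 ?sqr_ge0//; lra.
have : 0 <= g * f by rewrite mulr_ge0//; apply: le_trans H; rewrite addr_ge0 ?sqr_ge0.
by lra.
Qed.

(** The polynomial is the sum of [z^2 + 1 + p^2], which bounds [2 * p * (d + a)] up to [expR a], and
    of [p * (5 - 2 * p)], which bounds [p * (d + a)] when at most four other eigenvalues are
    nonzero. With a product at least 2, these contribute 4 and 2 to the constant 6. *)
Lemma exp_bound_det2 p z : 0 <= p -> 0 <= z ->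
  (1 + z) * (z ^+ 2 + 1 + 5 * p - p ^+ 2) <= 6 * expR (z + (p - 1)).
Proof.
move=> p0 z0; have := expR_shift_ge p z; have c1 := cubic1_le_expR z0.
have := expR_ge3 p0; have := expR_ge4 z0.
move: (expR z) (expR p) (expR (z + (p - 1))) c1 => g f e c1 Hg Hf He.
have p3 : 0 <= p ^+ 3 by rewrite exprn_ge0.
have f1 : 1 <= f by have := sqr_ge0 p; lra.
have g0 : 0 <= g.
  by apply: le_trans Hg; rewrite !addr_ge0 ?divr_ge0 ?exprn_ge0.
suff : (1 + z) * (z ^+ 2 + 1 + 5 * p - p ^+ 2) <= 219/100 * (g * f) by lra.
have [z2|z2] := leP 2 z.
  apply: (@le_trans _ _ ((1 + z) * (z ^+ 2 + 1) * f)); last first.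
    have : (1 + z) * (z ^+ 2 + 1) * f <= 43/20 * g * f by rewrite ler_wpM2r//; lra.
    by have : 0 <= g * f by [rewrite mulr_ge0//; lra]; lra.
  rewrite -mulrA ler_wpM2l//; first by lra.
  apply: (@le_trans _ _ ((z ^+ 2 + 1) * (1 + p))); last first.
    by rewrite ler_wpM2l ?addr_ge0 ?sqr_ge0//; have := sqr_ge0 p; lra.
  have := sqr_ge0 p; have : 0 <= (z ^+ 2 - 4) * p by rewrite mulr_ge0// subr_ge0; nra.
  by lra.
(* For [z < 2], [hz] interpolates linearly in [z^2] between [hf1] at 0 and [hf5] at 4. *)
have hf1 : 1 + 5 * p - p ^+ 2 <= 41/20 * f.
  have : 0 <= p * (p - 63/100) ^+ 2 by rewrite mulr_ge0 ?sqr_ge0.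
  have := sqr_ge0 (p - 63/100); lra.
have hf5 : 5 + 5 * p - p ^+ 2 <= 5 * f by have := sqr_ge0 p; lra.
have hz : z ^+ 2 + 1 + 5 * p - p ^+ 2 <= (41/20 + 59/80 * z ^+ 2) * f.
  have : 0 <= z ^+ 2 * (5 * f - (5 + 5 * p - p ^+ 2)) by rewrite mulr_ge0 ?sqr_ge0// subr_ge0.
  have : 0 <= (4 - z ^+ 2) * (41/20 * f - (1 + 5 * p - p ^+ 2)) by rewrite mulr_ge0 ?subr_ge0//; nra.
  by lra.
have hg : (1 + z) * (41/20 + 59/80 * z ^+ 2) <= 219/100 * g.
  apply: (@le_trans _ _ (219/100 * (1 + z + z ^+ 2 / 2 + z ^+ 3 / 6 + z ^+ 4 / 24))); last by lra.
  clear -z0 z2; nra.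
have : (1 + z) * (z ^+ 2 + 1 + 5 * p - p ^+ 2) <= (1 + z) * ((41/20 + 59/80 * z ^+ 2) * f).
  by rewrite ler_wpM2l//; lra.
have : (1 + z) * (41/20 + 59/80 * z ^+ 2) * f <= 219/100 * g * f by rewrite ler_wpM2r//; lra.
by lra.
Qed.

Lemma no_det3 a d e p z (D : R) : 0 <= a -> 0 < e -> 0 < p -> 0 <= z -> 3 <= D ->
  D * expR (z + a + e + p - 1) <= (d + a) * p * (1 + z) ->
  2 * p * (d - 1) <= z ^+ 2 + (1 - p) ^+ 2 + a ^+ 2 -> False.
Proof.
move=> a0 e0 p0 z0 D3 M1 M2.
have yP : (1 - p) ^+ 2 <= z ^+ 2 + (1 - p) ^+ 2 by have := sqr_ge0 z; lra.
have H1 := expR_absorb a0 p0 yP.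
have H2 := exp_bound_det3 (ltW p0) z0.
have H3 : 3 * (expR a * expR (z + (p - 1))) < (d + a) * p * (1 + z).
  apply: lt_le_trans M1; rewrite -expRD.
  have h : expR (a + (z + (p - 1))) < expR (z + a + e + p - 1) by rewrite ltr_expR; lra.
  have : 3 * expR (a + (z + (p - 1))) < 3 * expR (z + a + e + p - 1) by rewrite ltr_pM2l.
  have : 3 * expR (z + a + e + p - 1) <= D * expR (z + a + e + p - 1) by rewrite ler_pM2r ?expR_gt0.
  by lra.
have ea0 : 0 < expR a by exact: expR_gt0.
move: (expR a) (expR (z + (p - 1))) ea0 H1 H2 H3 => g f g0 H1 H2 H3.
have H4 : (2 * p * (d + a)) * (1 + z) <= g * (z ^+ 2 + 1 + p ^+ 2) * (1 + z).
  by rewrite ler_wpM2r//; lra.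
have H5 : g * ((1 + z) * (z ^+ 2 + 1 + p ^+ 2)) <= g * (6 * f) by rewrite ler_pM2l.
by lra.
Qed.

Lemma no_det2 a d e p z : 0 <= a -> 0 < e -> 0 < p -> 0 <= z -> 0 <= d ->
  2 * expR (z + a + e + p - 1) <= (d + a) * p * (1 + z) ->
  2 * p * (d - 1) <= z ^+ 2 + (1 - p) ^+ 2 + a ^+ 2 ->
  d + 2 * a + 2 * p + e <= 5 -> False.
Proof.
move=> a0 e0 p0 z0 d0 M1 M2 M3.
have yP : (1 - p) ^+ 2 <= z ^+ 2 + (1 - p) ^+ 2 by have := sqr_ge0 z; lra.
have H1 := expR_absorb a0 p0 yP.
have H2 := exp_bound_det2 (ltW p0) z0.
have H3 : 2 * (expR a * expR (z + (p - 1))) < (d + a) * p * (1 + z).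
  apply: lt_le_trans M1; rewrite -expRD.
  by rewrite ltr_pM2l// ltr_expR; lra.
have g1 : 1 <= expR a by have := expR_ge1Dx a; lra.
move: (expR a) (expR (z + (p - 1))) g1 H1 H2 H3 => g f g1 H1 H2 H3.
have g0 : 0 < g by lra.
have H4 : (2 * p * (d + a)) * (1 + z) <= g * (z ^+ 2 + 1 + p ^+ 2) * (1 + z).
  by rewrite ler_wpM2r//; lra.
have H5 : g * ((1 + z) * (z ^+ 2 + 1 + 5 * p - p ^+ 2)) <= g * (6 * f) by rewrite ler_pM2l.
have H6 : (d + a) * (p * (1 + z)) <= (5 - 2 * p) * (p * (1 + z)).
  rewrite ler_wpM2r ?mulr_ge0//; lra.
have H7 : 0 <= (g - 1) * ((5 - 2 * p) * (p * (1 + z))).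
  rewrite mulr_ge0//; first by lra.
  by rewrite mulr_ge0 ?mulr_ge0//; lra.
by lra.
Qed.

End DeterminantBounds.

(** * Second eigenvalue at least 1 *)

Section TangentBounds.
Variable R : realType.
Implicit Types (a b p x y z t d : R).

(** The inequality fails at [s = 1], [z = 2], where the left side is 18 and the right side
    [2 * expR 2 < 15]. The last hypothesis keeps away from this region, which is left to
    [no_near]. *)
Lemma exp_bound_far s z : 1 <= s -> 0 <= z -> 7/5 <= s \/ 4 <= z ->
  (1 + z) * (z ^+ 2 + 1 + s ^+ 2) <= 2 * expR (z + (s - 1)).
Proof.
move=> s1 z0 sz; rewrite expRD.
have c3 := cubic3_le_expR z0; have c2 := cubic2_le_expR z0; have e1 := expR_ge1Dx z.
have e6 := expR_ge6 z0.
have h0 : 0 <= s - 1 by lra.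
have := expR_ge3 h0; set h := s - 1 in h0 *; have sE : s = 1 + h by rewrite /h; ring.
move: (expR z) (expR h) c3 c2 e1 e6 => g f c3 c2 e1 e6 Hf.
have h3 : 0 <= h ^+ 3 by rewrite exprn_ge0.
have h2 : 0 <= h ^+ 2 by rewrite sqr_ge0.
have g1 : 1 <= g by lra.
suff H : (1 + z) * (z ^+ 2 + 1 + s ^+ 2) <= 2 * (g * (1 + h + h ^+ 2 / 2 + h ^+ 3 / 6)).
  by apply: le_trans H _; rewrite ler_pM2l// ler_wpM2l//; lra.
rewrite sE; have [z4|z4] := leP 4 z.
  have : (1 + z) * (z ^+ 2 + 2) <= 2 * g.
    have : (1 + z) * (z ^+ 2 + 2) <= 2 * (1 + z + z ^+ 2 / 2 + z ^+ 3 / 6 + z ^+ 4 / 24 + z ^+ 5 / 120 + z ^+ 6 / 720).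
      have [y y0 ->] : exists2 y, 0 <= y & z = 4 + y by exists (z - 4); [lra|ring].
      have : 0 <= y ^+ 2 by rewrite exprn_ge0.
      have : 0 <= y ^+ 3 by rewrite exprn_ge0.
      have : 0 <= y ^+ 4 by rewrite exprn_ge0.
      have : 0 <= y ^+ 5 by rewrite exprn_ge0.
      have : 0 <= y ^+ 6 by rewrite exprn_ge0.
      by lra.
    by lra.
  move=> H; have : 0 <= (2 * g - (1 + z) * (z ^+ 2 + 2)) * (1 + h + h ^+ 2 / 2).
    by rewrite mulr_ge0 ?subr_ge0//; lra.
  have : 0 <= (1 + z) * z ^+ 2 * (h + h ^+ 2 / 2) by rewrite !mulr_ge0 ?sqr_ge0//; lra.
  have : 0 <= g * h ^+ 3 by rewrite mulr_ge0//; lra.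
  by lra.
have h4 : 2/5 <= h by case: sz; lra.
have [hc|hc] := leP 2 ((1 + h) ^+ 2).
  have : 0 <= ((1 + h) ^+ 2 - 2) * (g - (1 + z)) by rewrite mulr_ge0 ?subr_ge0.
  have : 0 <= g * h ^+ 3 by rewrite mulr_ge0//; lra.
  by lra.
have : 0 <= ((1 + h) ^+ 2 - 1) * (3 * g - (1 + z) * (z ^+ 2 + 3)).
  by rewrite mulr_ge0 ?subr_ge0//; lra.
have : 0 <= (2 - (1 + h) ^+ 2) * (5/2 * g - (1 + z) * (z ^+ 2 + 2)).
  by rewrite mulr_ge0 ?subr_ge0//; lra.
have : 0 <= g * (h + h ^+ 2 / 2 + h ^+ 3 / 3 - 1/2).
  by rewrite mulr_ge0//; [lra|]; clear -h4; nra.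
by lra.
Qed.

(** In [pool_exp] with [u = 2/3], the left side is the growth of the bound per eigenvalue:
    [u * expR (1 / u - 1)]. *)
Lemma expR_half_le : 2/3 * expR (1/2 : R) <= expR (19/200).
Proof.
have q : 0 <= (1/4 : R) by lra.
have H := expRN_ge3 q.
have t : 0 <= (19/200 : R) by lra.
have := expR_ge3 t; move: (expR (19/200)) => e He.
have E : expR (1/2 : R) * expR (- (1/4)) ^+ 2 = 1.
  by rewrite -expRM_natl -expRD (_ : _ + _ = 0) ?expR0//; field.
have f0 : 0 < expR (1/2 : R) by exact: expR_gt0.
move: (expR (1/2)) (expR (- (1/4))) E f0 H => f g E f0 H.
have {H} H : 299/384 <= g by lra.
have g2 : (299/384) ^+ 2 <= g ^+ 2 by rewrite ler_pXn2r ?nnegrE//; lra.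
have : f * (299/384) ^+ 2 <= f * g ^+ 2 by rewrite ler_pM2l.
lra.
Qed.

(* Bounds [ln w] and [ln (1 + X)] by tangents, near [a] and [1 + x0]. *)
Lemma tangent_piece (a b x0 c w s X k : R) :
  0 < a -> 0 <= x0 -> a <= expR b -> 1 + x0 <= expR c -> 0 < w -> 0 <= X ->
  expR X <= w * (1 + X) * expR k ->
  x0 / (1 + x0) * X <= b + w / a - 1 + k + c - x0 / (1 + x0).
Proof.
move=> a0 x00 hb hc w0 X0 H.
have x1 : 0 < 1 + x0 by lra.
have hw : w <= expR (b + (w / a - 1)).
  rewrite expRD; apply: (@le_trans _ _ (a * (w / a))); first by rewrite mulrC divfK ?gt_eqF.
  by rewrite ler_pM ?expR_pred_ge ?divr_ge0// ltW.
have hX : 1 + X <= expR (c + ((1 + X) / (1 + x0) - 1)).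
  rewrite expRD; apply: (@le_trans _ _ ((1 + x0) * ((1 + X) / (1 + x0)))).
    by rewrite mulrC divfK ?gt_eqF.
  by rewrite ler_pM ?expR_pred_ge ?divr_ge0//; lra.
have : expR X <= expR (b + (w / a - 1) + (c + ((1 + X) / (1 + x0) - 1)) + k).
  apply: le_trans H _; rewrite [leRHS]expRD ler_wpM2r ?expR_ge0// expRD.
  by rewrite ler_pM//; lra.
rewrite ler_expR.
have -> : x0 / (1 + x0) = 1 - (1 + x0)^-1 by field; rewrite gt_eqF.
lra.
Qed.

End TangentBounds.

Section NearBounds.
Variable R : realType.
Implicit Types (a b p x y z t d : R).

(** These products of linear constraints let [lra] decide quadratic inequalities in [w] and [s] on a
    rectangle. *)
Lemma rectangle_products (w s w1 w2 s1 s2 : R) : w1 <= w <= w2 -> s1 <= s <= s2 ->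
  [/\ 0 <= (w - w1) * (w2 - w), 0 <= (w - w1) * (s - s1), 0 <= (w - w1) * (s2 - s),
     0 <= (w2 - w) * (s - s1) & 0 <= (w2 - w) * (s2 - s)].
Proof. by move=> /andP[? ?] /andP[? ?]; rewrite !mulr_ge0 ?subr_ge0. Qed.

(** On each of three intervals of [w], tangents turn the exponential inequality into an upper bound
    on [X] that is linear in [w] and [s]; its square contradicts the quadratic lower bound. Each
    exponent in an [h1] or [h2] is a rational number slightly above the logarithm concerned. *)
Lemma no_near (w s X : R) :
  31/20 <= w <= 10 -> 1 <= s <= 7/5 -> 0 <= X ->
  expR X <= w * (1 + X) * expR (19/200 * (w + s) + 3/2 * (1 - s)) ->
  2 * w - s ^+ 2 - 1 + 2/3 * (1 - s) + 1/3 <= 4/9 * X ^+ 2 -> False.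
Proof.
move=> /andP[w1 w2] s12 X0 H1 H2; have /andP[s1 s2] := s12.
have sw : 0 <= (s - 1) * (7/5 - s) by rewrite mulr_ge0//; lra.
have [wa|wa] := leP w (19/10).
  have h1 : (169/100 : R) <= expR (21/40).
    by apply: le_trans (@expR_ge6 R (21/40) _); lra.
  have h2 : 1 + (11/10 : R) <= expR (371/500).
    by apply: le_trans (@expR_ge6 R (371/500) _); lra.
  have := @tangent_piece R (169/100) (21/40) (11/10) (371/500) w s X
    (19/200 * (w + s) + 3/2 * (1 - s)).
  have -> : (11/10 : R) / (1 + 11/10) = 11/21 by field.
  move=> /(_ _ _ h1 h2 _ X0 H1) K.
  have {K} K : 11/21 * X <= 21/40 + w / (169/100) - 1 + (19/200 * (w + s) + 3/2 * (1 - s)) + 371/500 - 11/21.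
    by apply: K; lra.
  have [|ww p1 p2 p3 p4] := @rectangle_products w s (31/20) (19/10) 1 (7/5) _ s12; first by lra.
  clear h1 h2 H1.
  set L := (X in _ <= X) in K.
  have L2 : (11/21 * X) ^+ 2 <= L ^+ 2 by rewrite ler_pXn2r ?nnegrE//; [|apply: le_trans K]; rewrite mulr_ge0//; lra.
  by rewrite /L in L2; lra.
have [wb|wb] := leP w 4.
  have h1 : (58/25 : R) <= expR (421/500).
    by apply: le_trans (@expR_ge6 R (421/500) _); lra.
  have h2 : 1 + (21/10 : R) <= expR (283/250).
    by apply: le_trans (@expR_ge6 R (283/250) _); lra.
  have := @tangent_piece R (58/25) (421/500) (21/10) (283/250) w s X
    (19/200 * (w + s) + 3/2 * (1 - s)).
  have -> : (21/10 : R) / (1 + 21/10) = 21/31 by field.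
  move=> /(_ _ _ h1 h2 _ X0 H1) K.
  have {K} K : 21/31 * X <= 421/500 + w / (58/25) - 1 + (19/200 * (w + s) + 3/2 * (1 - s)) + 283/250 - 21/31.
    by apply: K; lra.
  have [|ww p1 p2 p3 p4] := @rectangle_products w s (19/10) (4) 1 (7/5) _ s12; first by lra.
  clear h1 h2 H1.
  set L := (X in _ <= X) in K.
  have L2 : (21/31 * X) ^+ 2 <= L ^+ 2 by rewrite ler_pXn2r ?nnegrE//; [|apply: le_trans K]; rewrite mulr_ge0//; lra.
  by rewrite /L in L2; lra.
have h1 : (4 : R) <= expR (7/5).
  by apply: le_trans (@expR_ge6 R (7/5) _); lra.
have h2 : 1 + (43/10 : R) <= expR (17/10).
  by apply: le_trans (@expR_ge6 R (17/10) _); lra.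
have := @tangent_piece R 4 (7/5) (43/10) (17/10) w s X
  (19/200 * (w + s) + 3/2 * (1 - s)).
have -> : (43/10 : R) / (1 + 43/10) = 43/53 by field.
move=> /(_ _ _ h1 h2 _ X0 H1) K.
have {K} K : 43/53 * X <= 7/5 + w / 4 - 1 + (19/200 * (w + s) + 3/2 * (1 - s)) + 17/10 - 43/53.
  by apply: K; lra.
have [|ww p1 p2 p3 p4] := @rectangle_products w s (4) (10) 1 (7/5) _ s12; first by lra.
clear h1 h2 H1.
set L := (X in _ <= X) in K.
have L2 : (43/53 * X) ^+ 2 <= L ^+ 2 by rewrite ler_pXn2r ?nnegrE//; [|apply: le_trans K]; rewrite mulr_ge0//; lra.
by rewrite /L in L2; lra.
Qed.

End NearBounds.

(** * Lists of eigenvalues *)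

Section Pooling.
Variable R : realType.
Implicit Types (a b p x y z d : R) (t : seq R).

(** The last hypothesis is [2 * (d + a) * p <= z^2 + 1 + (p + a)^2], so [p] and [a] matter only
    through [p + a] and [(d + a) * p]. If the latter is at least 10 while [p + a < 7/5], it forces
    [z >= 4]. *)
Lemma no_far a d e p z : 0 <= a -> 0 < e -> 1 <= p -> 0 <= z -> 1 <= d ->
  7/5 <= p + a \/ 10 <= (d + a) * p ->
  expR (z + a + e + p - 1) <= (d + a) * p * (1 + z) ->
  2 * p * (d - 1) <= z ^+ 2 + (1 - p) ^+ 2 + a ^+ 2 -> False.
Proof.
move=> a0 e0 p1 z0 d1 H M1 M2.
have H0 : 7/5 <= p + a \/ 4 <= z.
  have [sa|sa] := leP (7/5) (p + a); first exact: or_introl.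
  case: H => [H|H]; first by lra.
  apply: or_intror; rewrite leNgt; apply/negP => z4.
  have : z ^+ 2 < 4 ^+ 2 by rewrite ltr_pXn2r ?nnegrE//; lra.
  have : (p + a) ^+ 2 < (7/5) ^+ 2 by rewrite ltr_pXn2r ?nnegrE//; lra.
  lra.
have s1 : 1 <= p + a by lra.
have K := exp_bound_far s1 z0 H0.
have K2 : expR (z + (p + a - 1)) < (d + a) * p * (1 + z).
  by apply: lt_le_trans M1; rewrite ltr_expR; lra.
have : 2 * ((d + a) * p) * (1 + z) <= (z ^+ 2 + 1 + (p + a) ^+ 2) * (1 + z).
  by rewrite ler_wpM2r//; lra.
lra.
Qed.

(** This is [prod1D_le_expR] for the numbers [|x| / u - 1]. The scale [u] is 1 everywhere except in
    [abs_sum_ge_lambda2], where it is 2/3. *)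
Lemma pool_exp t (u : R) : 0 < u -> all (fun x => x != 0) t ->
  exists2 z, 0 <= z &
    z ^+ 2 * u ^+ 2 = \sum_(x <- t) x ^+ 2 - 2 * u * (\sum_(x <- t) `|x|) + (size t)%:R * u ^+ 2 /\
    (\prod_(x <- t) `|x|) * expR z <=
      u ^+ size t * expR ((\sum_(x <- t) `|x|) / u - (size t)%:R) * (1 + z).
Proof.
move=> u0 /allP t0.
pose s := [seq `|x| / u - 1 | x <- t].
have s0 : 0 <= \sum_(y <- s) y ^+ 2 by rewrite sumr_ge0// => y _; exact: sqr_ge0.
exists (Num.sqrt (\sum_(y <- s) y ^+ 2)); first exact: sqrtr_ge0.
set z := Num.sqrt _; have zE : \sum_(y <- s) y ^+ 2 = z ^+ 2 by rewrite sqr_sqrtr.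
split.
  rewrite -zE /s big_map mulr_suml.
  rewrite mulr_sumr -sumrB -(sum1_size t) natr_sum mulr_suml -big_split /=.
  apply: eq_bigr => x _; rewrite -[x ^+ 2]real_normK ?num_real//.
  by field; rewrite gt_eqF.
have s1 : {in s, forall y, -1 < y}.
  move=> _ /mapP[x xt ->]; have : 0 < `|x| / u by rewrite divr_gt0 ?normr_gt0 ?t0.
  lra.
have := prod1D_le_expR s1 (sqrtr_ge0 _) zE; rewrite -/z /s !big_map => H.
have -> : \prod_(x <- t) `|x| = u ^+ size t * \prod_(x <- t) (1 + (`|x| / u - 1)).
  elim: t {t0 s s0 z zE s1 H} => [|x t IH]; first by rewrite !big_nil expr0 mulr1.
  rewrite !big_cons IH /= exprS; move: (\prod_(_ <- _) _) => P.
  by field; rewrite gt_eqF.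
rewrite -!mulrA ler_pM2l ?exprn_gt0//.
have -> : (\sum_(x <- t) `|x|) / u - (size t)%:R = \sum_(x <- t) (`|x| / u - 1).
  by rewrite sumrB mulr_suml -(sum1_size t) natr_sum.
exact: H.
Qed.

(* [P], [Q] and [pr] are the sum, the sum of squares and the product of [q]
   eigenvalues that are kept apart from the pool [t]. *)
Lemma pool_master (n q : nat) (D l d P Q pr : R) t :
  all (fun x => x != 0) t -> 0 < pr -> 0 < l -> 1 < d -> d <= l ->
  let N := (size t + q)%N in
  let E := l + P + \sum_(x <- t) `|x| in
  let e := N%:R + d - E in
  let a := l - d in
  (N < n)%N ->
  l ^+ 2 + Q + \sum_(x <- t) x ^+ 2 = n%:R * d ->
  2 * (l + P) <= E -> 0 < e ->
  D <= l * pr * \prod_(x <- t) `|x| ->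
  exists2 z, 0 <= z & D * expR (z + a + e + P - q%:R) <= l * pr * (1 + z) /\
    2 * P * (d - 1) + e * (d + 1) + (n - N.+1)%:R * d <= z ^+ 2 + (q%:R - 2 * P + Q) + a ^+ 2.
Proof.
move=> t0 pr0 l0 d1 dl N E e a Nn sqE EP e0 DE.
have [z z0 [zE zP]] := pool_exp ltr01 t0; exists z => //; split.
  have lp : 0 < l * pr by rewrite mulr_gt0.
  have -> : z + a + e + P - q%:R = z - ((\sum_(x <- t) `|x|) / 1 - (size t)%:R).
    by rewrite /a /e /E /N natrD divr1; ring.
  rewrite expRB mulrA ler_pdivrMr ?expR_gt0//.
  apply: (@le_trans _ _ (l * pr * \prod_(x <- t) `|x| * expR z)).
    by rewrite ler_wpM2r ?expR_ge0.
  rewrite -!mulrA ler_pM2l// ler_pM2l//.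
  by move: zP; rewrite expr1n mul1r [in leRHS]mulrC.
rewrite !expr1n !mulr1 in zE; rewrite zE.
have nE : n%:R = (n - N.+1)%:R + N%:R + 1 :> R by rewrite -{1}(subnK Nn) natrD -natr1 addrA.
have NE : N%:R = (size t)%:R + q%:R :> R by rewrite natrD.
move: sqE EP; rewrite /e /a /E nE NE => sqE EP.
(* The two sides of the goal differ exactly by this product; this is where the trace enters, through
   [2 * (l + P) <= E]. *)
have : 0 <= (\sum_(x <- t) `|x| - l - P) * (d - 1) by rewrite mulr_ge0//; lra.
lra.
Qed.

End Pooling.

(** * Lower bounds for the sum of absolute values *)

Section AbsoluteSums.
Variable R : realType.
Implicit Types (a b p x y z d l : R) (t : seq R).

Lemma abs_sum_ge_two_positive (n : nat) l d p1 p2 t :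
  all (fun x => x != 0) t -> 0 < p1 -> 0 < p2 -> 1 < d -> d <= l ->
  (size t + 3 <= n)%N -> l + p1 + p2 + \sum_(x <- t) x = 0 ->
  l ^+ 2 + p1 ^+ 2 + p2 ^+ 2 + \sum_(x <- t) x ^+ 2 = n%:R * d ->
  1 <= l * p1 * p2 * \prod_(x <- t) `|x| ->
  (size t + 3)%:R + d - 1 <= l + p1 + p2 + \sum_(x <- t) `|x|.
Proof.
move=> t0 p10 p20 d1 dl tn tr sq D1; rewrite leNgt; apply/negP => H.
have S : l + p1 + p2 <= \sum_(x <- t) `|x|.
  have : - \sum_(x <- t) x <= \sum_(x <- t) `|x| by rewrite -sumrN ler_sum// => x _; rewrite -normrN ler_norm.
  lra.
have l0 : 0 < l by lra.
have pr0 : 0 < p1 * p2 by rewrite mulr_gt0.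
have Nn : (size t + 2 < n)%N by rewrite -addnS.
have H' : l + p1 + p2 + \sum_(x <- t) `|x| < (size t + 2)%:R + d.
  by apply: lt_le_trans H _; rewrite !natrD; lra.
have [||||z z0 [M1 M2]] := @pool_master R n 2 1 l d (p1 + p2) (p1 ^+ 2 + p2 ^+ 2) (p1 * p2) t t0 pr0 l0 d1 dl Nn.
- by rewrite -sq; ring.
- by lra.
- by lra.
- by rewrite mulrA.
have lE : l = d + (l - d) by ring.
move: M1; rewrite mul1r [X in _ <= X * _ * _]lE => M1; apply: no_two_positive p10 p20 z0 M1 _; [lra|lra|].
have : 0 <= ((size t + 2)%:R + d - (l + (p1 + p2) + \sum_(x <- t) `|x|)) * (d + 1).
  by rewrite mulr_ge0//; lra.
have : 0 <= (n - (size t + 2).+1)%:R * d by rewrite mulr_ge0//; lra.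
lra.
Qed.

Lemma pool_one (n : nat) (D l d p : R) t :
  all (fun x => x != 0) t -> 0 < p -> 1 < d -> d <= l ->
  (size t + 2 <= n)%N -> l + p + \sum_(x <- t) x = 0 ->
  l ^+ 2 + p ^+ 2 + \sum_(x <- t) x ^+ 2 = n%:R * d ->
  D <= l * p * \prod_(x <- t) `|x| ->
  l + p + \sum_(x <- t) `|x| < (size t + 2)%:R + d - 1 ->
  exists z e, [/\ 0 <= z, 0 < e, e = (size t + 1)%:R + d - (l + p + \sum_(x <- t) `|x|),
    D * expR (z + (l - d) + e + p - 1) <= (d + (l - d)) * p * (1 + z) &
    2 * p * (d - 1) + (n - (size t + 2))%:R * d <= z ^+ 2 + (1 - p) ^+ 2 + (l - d) ^+ 2].
Proof.
move=> t0 p0 d1 dl tn tr sq D1 H.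
have S : l + p <= \sum_(x <- t) `|x|.
  have : - \sum_(x <- t) x <= \sum_(x <- t) `|x| by rewrite -sumrN ler_sum// => x _; rewrite -normrN ler_norm.
  lra.
have l0 : 0 < l by lra.
have Nn : (size t + 1 < n)%N by rewrite -addnS.
have H' : l + p + \sum_(x <- t) `|x| < (size t + 1)%:R + d.
  by apply: lt_le_trans H _; rewrite !natrD; lra.
have [|||z z0 [M1 M2]] := @pool_master R n 1 D l d p (p ^+ 2) p t t0 p0 l0 d1 dl Nn sq.
- by lra.
- by lra.
- by [].
exists z, ((size t + 1)%:R + d - (l + p + \sum_(x <- t) `|x|)); split=> //.
- by lra.
- by rewrite (_ : d + (l - d) = l); [lra|ring].
rewrite -addnS in M2.
have : 0 <= ((size t + 1)%:R + d - (l + p + \sum_(x <- t) `|x|)) * (d + 1).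
  by rewrite mulr_ge0//; lra.
lra.
Qed.

Lemma abs_sum_ge_singular (n : nat) l d p t :
  all (fun x => x != 0) t -> 0 < p -> 1 < d -> d <= l ->
  (size t + 2 < n)%N -> l + p + \sum_(x <- t) x = 0 ->
  l ^+ 2 + p ^+ 2 + \sum_(x <- t) x ^+ 2 = n%:R * d ->
  1 <= l * p * \prod_(x <- t) `|x| ->
  (size t + 2)%:R + d - 1 <= l + p + \sum_(x <- t) `|x|.
Proof.
move=> t0 p0 d1 dl tn tr sq D1; rewrite leNgt; apply/negP => H.
have [z [e [z0 e0 _ M1 M2]]] := pool_one t0 p0 d1 dl (ltnW tn) tr sq D1 H.
rewrite mul1r in M1; apply: no_singular M1 _ => //; first lra.
have : 1 * d <= (n - (size t + 2))%:R * d.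
  by rewrite ler_wpM2r ?ler1n ?subn_gt0//; lra.
lra.
Qed.

Lemma abs_sum_ge_det (n : nat) (D l d p : R) t :
  all (fun x => x != 0) t -> 0 < p -> 1 < d -> d <= l ->
  (size t + 2 <= n)%N -> l + p + \sum_(x <- t) x = 0 ->
  l ^+ 2 + p ^+ 2 + \sum_(x <- t) x ^+ 2 = n%:R * d ->
  D <= l * p * \prod_(x <- t) `|x| -> 3 <= D \/ 2 <= D /\ (size t <= 4)%N ->
  (size t + 2)%:R + d - 1 <= l + p + \sum_(x <- t) `|x|.
Proof.
move=> t0 p0 d1 dl tn tr sq DD HD; rewrite leNgt; apply/negP => H.
have M0 : 0 <= (n - (size t + 2))%:R * d by rewrite mulr_ge0//; lra.
case: HD => [D3|[D2 t4]].
  have [z [e [z0 e0 _ M1 M2]]] := pool_one t0 p0 d1 dl tn tr sq DD H.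
  by apply: no_det3 D3 M1 _ => //; lra.
have {}DD : 2 <= l * p * \prod_(x <- t) `|x| by apply: le_trans DD.
have [z [e [z0 e0 eE M1 M2]]] := pool_one t0 p0 d1 dl tn tr sq DD H.
have S : l + p <= \sum_(x <- t) `|x|.
  have : - \sum_(x <- t) x <= \sum_(x <- t) `|x| by rewrite -sumrN ler_sum// => x _; rewrite -normrN ler_norm.
  lra.
have : (size t)%:R <= 4 :> R by rewrite (ler_nat _ _ 4).
rewrite natrD in eE => t4R; apply: no_det2 M1 _ _ => //; lra.
Qed.

(** Here [k] negative eigenvalues remain, with absolute values of sum exactly [l + p], so [k] is
    expressed by [l], [p], [d] and [e]. [no_far] confines [w = l * p] and [s = p + l - d] to a
    bounded region, and there the pooling around 2/3 closes the case. *)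
Lemma no_lambda2 (k : nat) l d p e z X P : 1 <= p -> 1 < d -> d <= l -> 0 < e -> 0 <= z -> 0 <= X ->
  (3 <= k)%N -> k%:R = l + p + (p + (l - d)) - 1 + e -> 1 <= l * p * P ->
  expR (z + (l - d) + e + p - 1) <= (d + (l - d)) * p * (1 + z) ->
  2 * p * (d - 1) <= z ^+ 2 + (1 - p) ^+ 2 + (l - d) ^+ 2 ->
  X ^+ 2 * (2/3) ^+ 2 = (k%:R + 2) * d - l ^+ 2 - p ^+ 2 - 2 * (2/3) * (l + p) + k%:R * (2/3) ^+ 2 ->
  P * expR X <= (2/3) ^+ k * expR ((l + p) / (2/3) - k%:R) * (1 + X) -> False.
Proof.
move=> p1 d1 dl e0 z0 X0 k3 kE D1 M1 M2 XE XP.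
have {}k3 : 3 <= k%:R :> R by rewrite (ler_nat _ 3).
have l1 : 1 <= l by lra.
have a0 : 0 <= l - d by lra.
have d1' : 1 <= d by exact: ltW.
have X1 : 0 <= 1 + X by rewrite addr_ge0.
pose w := l * p; pose s := p + (l - d).
have w0 : 0 <= w by rewrite mulr_ge0 ?(le_trans ler01).
have wE : (d + (l - d)) * p = w by rewrite /w; ring.
have lw : l + p <= w + 1.
  have : 0 <= (l - 1) * (p - 1) by rewrite mulr_ge0 ?subr_ge0.
  by rewrite /w; clear; lra.
have Hfar : ~ (7/5 <= s \/ 10 <= w).
  by rewrite -wE => far; exact: (no_far a0 e0 p1 z0 d1' far M1 M2).
have s75 : s <= 7/5 by rewrite leNgt; apply/negP => h; apply: Hfar; exact/or_introl/ltW.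
have w10 : w <= 10 by rewrite leNgt; apply/negP => h; apply: Hfar; exact/or_intror/ltW.
have w31 : 31/20 <= w.
  (* As [k >= 3] and [l + p <= w + 1], a small [w] makes [(l - d) + e + p - 1 = k - (l + p)] exceed
     9/20; but [expR (9/20) > 31/20]. *)
  rewrite leNgt; apply/negP => w31.
  have : expR z * expR (9/20) <= w * expR z.
    rewrite -expRD; apply: (@le_trans _ _ (expR (z + (l - d) + e + p - 1))).
      by rewrite ler_expR; move: lw w31 k3; rewrite kE; clear; lra.
    by apply: le_trans M1 _; rewrite wE ler_wpM2l ?expR_ge1Dx.
  rewrite mulrC ler_pM2r ?expR_gt0// => h.
  have q : 0 <= (9/20 : R) by clear; lra.
  by move: (expR_ge3 q) h w31; clear; lra.
apply: (@no_near R w s X) => //.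
- by rewrite w31.
- by rewrite s75 andbT /s -[leLHS]addr0 lerD.
- have H1 : expR X <= w * (P * expR X).
    by rewrite mulrA -[leLHS]mul1r ler_wpM2r ?expR_ge0.
  apply: (le_trans H1); rewrite -[leRHS]mulrA ler_wpM2l//.
  apply: (le_trans XP); rewrite [leRHS]mulrC ler_wpM2r//.
  have -> : (l + p) / (2/3) - k%:R = k%:R * (1/2) + 3/2 * (1 - s - e).
    by rewrite kE /s; field.
  rewrite [X in _ * X <= _]expRD [leLHS]mulrA expRM_natl -exprMn.
  have h : (2/3 * expR (1/2 : R)) ^+ k <= expR (19/200) ^+ k.
    by rewrite lerXn2r ?nnegrE ?mulr_ge0 ?expR_ge0 ?expR_half_le ?invr_ge0.
  apply: (@le_trans _ _ (expR (19/200) ^+ k * expR (3/2 * (1 - s - e)))).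
    by rewrite ler_wpM2r ?expR_ge0.
  by rewrite -expRM_natl -expRD ler_expR kE /s; move: lw e0; clear; rewrite /w; lra.
(* The summand 1/3 in the goal is a lower bound for [k / 9]; this is where [k >= 3], hence [n >= 5],
   matters. *)
have : 0 <= e * (d - 1) by rewrite mulr_ge0 ?subr_ge0// ltW.
by move: XE k3 p1 d1 dl e0; rewrite kE /w /s; clear; lra.
Qed.

Lemma abs_sum_ge_lambda2 (n : nat) l d p t :
  all (fun x => x < 0) t -> 1 <= p -> 1 < d -> d <= l ->
  (size t + 2 = n)%N -> (5 <= n)%N -> l + p + \sum_(x <- t) x = 0 ->
  l ^+ 2 + p ^+ 2 + \sum_(x <- t) x ^+ 2 = n%:R * d ->
  1 <= l * p * \prod_(x <- t) `|x| ->
  (size t + 2)%:R + d - 1 <= l + p + \sum_(x <- t) `|x|.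
Proof.
move=> tneg p1 d1 dl tn n5 tr sq D1; rewrite leNgt; apply/negP => H.
have t0 : all (fun x => x != 0) t by apply: sub_all tneg => x /lt_eqF ->.
have p0 : 0 < p by exact: lt_le_trans p1.
have SE : \sum_(x <- t) `|x| = l + p.
  have -> : \sum_(x <- t) `|x| = \sum_(x <- t) - x.
    by apply: eq_big_seq => x /(allP tneg) x0; rewrite ltr0_norm.
  by rewrite sumrN; apply/eqP; rewrite eq_sym -addr_eq0; apply/eqP.
have tn' : (size t + 2 <= n)%N by rewrite tn.
have [z [e [z0 e0 eE M1 M2]]] := pool_one t0 p0 d1 dl tn' tr sq D1 H.
rewrite mul1r in M1.
have {}M2 : 2 * p * (d - 1) <= z ^+ 2 + (1 - p) ^+ 2 + (l - d) ^+ 2.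
  by apply: le_trans M2; rewrite lerDl mulr_ge0// ltW// (lt_trans ltr01).
have u0 : 0 < (2/3 : R) by rewrite divr_gt0.
have [X X0 [XE XP]] := pool_exp u0 t0.
have k3 : (3 <= size t)%N by rewrite -(leq_add2r 2) tn.
rewrite SE in XE XP; apply: no_lambda2 p1 d1 dl e0 z0 X0 k3 _ D1 M1 M2 _ XP.
  by rewrite eE SE natrD; ring.
rewrite XE; congr (_ - _ + _).
have -> : \sum_(x <- t) x ^+ 2 = n%:R * d - (l ^+ 2 + p ^+ 2) by rewrite -sq addrC addKr.
by rewrite -tn natrD opprD addrA.
Qed.

End AbsoluteSums.

(** * Spectra of symmetric matrices *)

Section Spectrum.
Local Open Scope sesquilinear_scope.
Variable R : rcfType.

Lemma spectrum_diag n (A : 'M[R]_n) : A^T = A ->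
  exists (U : 'M[R[i]]_n) (v : 'rV[R]_n),
  [/\ U \is unitarymx,
      map_mx (real_complex R) A = U^t* *m diag_mx (map_mx (real_complex R) v) *m U &
      perm_eq (spectrum A) [seq v 0 i | i <- enum 'I_n]].
Proof.
move=> symA; pose B : 'M[R[i]]_n := map_mx (real_complex R) A.
have hB : B \is hermsymmx.
  apply: realsym_hermsym.
    apply/is_hermitianmxP; rewrite expr0 scale1r.
    by apply/matrixP=> i j; rewrite !mxE -{1}symA mxE.
  by apply/mxOverP => i j; rewrite mxE; apply/complex_realP; exists (A i j).
have /mxOverP rd := hermitian_spectral_diag_real hB.
have /orthomx_spectralP eB := hermitian_normalmx hB.
have uU := spectral_unitarymx B.
pose v : 'rV[R]_n := map_mx (@complex.Re R) (spectral_diag B).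
have vE : map_mx (real_complex R) v = spectral_diag B.
  by apply/rowP => i; rewrite !mxE RRe_real.
exists (spectralmx B), v; split => //.
  by rewrite -/B vE [in LHS]eB invmx_unitary.
apply: prod_XsubC_eq; rewrite -char_poly_spectrum// big_map big_enum /=.
apply: (map_poly_inj (real_complex R)).
rewrite map_char_poly -/B rmorph_prod /=.
have -> : char_poly B = char_poly (diag_mx (spectral_diag B)).
  have uP : spectralmx B \in unitmx by exact: spectral_unit.
  rewrite [in LHS]eB; exact: char_poly_conj.
rewrite char_poly_trig ?diag_mx_is_trig //; apply: eq_bigr => i _.
by rewrite map_polyXsubC mxE eqxx mulr1n -vE mxE.
Qed.

Lemma sum_spectrum n (A : 'M[R]_n) : A^T = A -> \sum_(x <- spectrum A) x = \tr A.
Proof.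
move=> symA; have [U [v [uU AE vE]]] := spectrum_diag symA.
rewrite (perm_big _ vE) big_map big_enum /=.
apply: (fmorph_inj (real_complex R)); rewrite -trace_map_mx AE -mulmxA mxtrace_mulC.
rewrite -mulmxA (unitarymxP uU) mulmx1 mxtrace_diag rmorph_sum.
by apply: eq_bigr => i _; rewrite mxE.
Qed.

Lemma sum_sqr_spectrum n (A : 'M[R]_n) : A^T = A ->
  \sum_(x <- spectrum A) x ^+ 2 = \tr (A *m A).
Proof.
move=> symA; have [U [v [uU AE vE]]] := spectrum_diag symA.
rewrite (perm_big _ vE) big_map big_enum /=.
apply: (fmorph_inj (real_complex R)); rewrite -trace_map_mx map_mxM AE.
rewrite mxtrace_mulC -!mulmxA (mulmxA U) (unitarymxP uU) mul1mx.
rewrite mxtrace_mulC -!mulmxA (unitarymxP uU) mulmx1 mulmx_diag mxtrace_diag rmorph_sum.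
by apply: eq_bigr => i _; rewrite !mxE rmorphXn.
Qed.

Lemma rank_diag_mx_le (F : fieldType) n (v : 'rV[F]_n) :
  (\rank (diag_mx v) <= #|[set i | v 0%R i != 0%R]|)%N.
Proof.
set S := [set i | _].
have -> : diag_mx v = (\matrix_(i < n, k < #|S|) (v 0 i *+ (enum_val k == i))) *m
   (\matrix_(k < #|S|, j < n) (enum_val k == j)%:R).
  apply/matrixP => i j; rewrite !mxE.
  under eq_bigr do rewrite !mxE.
  have [iS|iS] := boolP (i \in S); last first.
    have vi : v 0 i = 0 by move: iS; rewrite inE negbK => /eqP.
    by rewrite vi mul0rn big1// => k _; rewrite mul0rn mul0r.
  rewrite (bigD1 (enum_rank_in iS i))//= enum_rankK_in// eqxx mulr1n big1 ?addr0 ?mulr_natr//.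
  move=> k ki; have [ke|] := eqVneq (enum_val k) i; last by rewrite mulr0n mul0r.
  by case/negP: ki; rewrite -(inj_eq enum_val_inj) enum_rankK_in// ke.
exact: mulmx_max_rank.
Qed.

Lemma count_enum_rV n (v : 'rV[R]_n) (P : pred R) :
  count P [seq v 0 i | i <- enum 'I_n] = #|[set i | P (v 0 i)]|.
Proof.
rewrite count_map -sum1_count big_enum_cond /= -sum1_card.
by apply: eq_bigl => i; rewrite inE.
Qed.

Lemma rank_le_count_spectrum n (A : 'M[R]_n) : A^T = A ->
  (\rank A <= count (fun x => x != 0%R) (spectrum A))%N.
Proof.
move=> symA; have [U [v [uU AE /permP ->]]] := spectrum_diag symA.
rewrite count_enum_rV -(mxrank_map (real_complex R)) AE.
apply: leq_trans (mxrankM_maxl _ _) _; apply: leq_trans (mxrankM_maxr _ _) _.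
apply: leq_trans (rank_diag_mx_le _) _; rewrite leq_eqVlt; apply/orP; left.
by apply/eqP/eq_card => i; rewrite !inE mxE fmorph_eq0.
Qed.

(* Up to sign, this product is the lowest nonzero coefficient of the
   characteristic polynomial, an integer. *)
Lemma prod_nonzero_spectrum n (A : 'M[int]_n) :
  (map_mx intr A)^T = map_mx intr A :> 'M[R]_n ->
  1 <= \prod_(x <- spectrum (map_mx intr A : 'M[R]_n) | x != 0) `|x|.
Proof.
set B := map_mx intr A => symB.
have : char_poly B = map_poly intr (char_poly A) by rewrite map_char_poly.
rewrite char_poly_spectrum// => /(congr1 (fun p : {poly R} => p`_(count (pred1 0) (spectrum B)))).
rewrite (bigID (fun x => x != 0)) /= mulrC.
have -> : \prod_(x <- spectrum B | ~~ (x != 0)) ('X - x%:P) = 'X^(count (pred1 0) (spectrum B)).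
  rewrite -big_filter (eq_big_seq (fun=> 'X)); last first.
    by move=> x; rewrite mem_filter negbK => /andP[/eqP-> _]; rewrite subr0.
  rewrite big_const_seq count_predT size_filter iter_mulr_1.
  by congr ('X^ _); apply: eq_count => x; rewrite /= negbK.
rewrite coefXnM ltnn subnn coef_map /=.
have -> : \prod_(x <- spectrum B | x != 0) ('X - x%:P) =
          \prod_(x <- [seq x <- spectrum B | x != 0]) ('X - x%:P) by rewrite big_filter.
rewrite coef0_prod_XsubC => H.
have : `|\prod_(x <- spectrum B | x != 0) x| = `|(char_poly A)`_(count (pred1 0) (spectrum B))|%:~R.
  move/(congr1 Num.norm): H; rewrite normrM normrX normrN1 expr1n mul1r big_filter => ->.
  by rewrite intr_norm.
rewrite -normr_prod; set c : int := `|(char_poly A)`_ _| => E; rewrite E.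
have c0 : c != 0.
  apply/eqP => c0; move: E; rewrite c0 mulr0z => /eqP; rewrite normr_eq0 prodf_seq_eq0.
  by case/hasP => x _ /andP[/negPf ->].
have c1 : 1 <= c by rewrite -gtz0_ge1 lt_neqAle eq_sym c0 normr_ge0.
by rewrite (ler_int _ 1).
Qed.

Lemma norm_det_spectrum n (A : 'M[R]_n) : A^T = A ->
  \prod_(x <- spectrum A) `|x| = `|\det A|.
Proof.
move=> symA; have /(congr1 (fun p : {poly R} => p`_0)) := char_poly_spectrum symA.
rewrite char_poly_det coef0_prod_XsubC => /(congr1 Num.norm).
by rewrite !normrM !normrX !normrN1 !expr1n !mul1r => ->; rewrite normr_prod.
Qed.

(** Multiplying by the adjugate gives [\det A *: w = M *: (\adj A *m y)], which is read at an entry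
    where [w] is 1. *)
Lemma dvd_det n (A : 'M[int]_n) (w y : 'cV[int]_n) (M : int) i :
  A *m w = M *: y -> w i 0 = 1 -> (M %| \det A)%Z.
Proof.
move=> Aw wi; have /colP/(_ i) : \adj A *m (A *m w) = M *: (\adj A *m y) by rewrite Aw scalemxAr.
by rewrite mulmxA mul_adj_mx mul_scalar_mx !mxE wi mulr1 => ->; rewrite dvdz_mulr.
Qed.

End Spectrum.

(** * Counting eigenvalues with test spaces *)

Section CountSpectrum.
Local Open Scope sesquilinear_scope.
Variable R : rcfType.

(** It transfers a sign condition on real vectors to complex ones, since [spectrum_diag]
    diagonalizes over [R[i]]. *)
Lemma form_complex k (G : 'M[R]_k) (z : 'rV[R[i]]_k) : G^T = G ->
  exists a b : 'rV[R]_k,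
    (z *m map_mx (real_complex R) G *m z^t*) 0 0 =
    ((a *m G *m a^T) 0 0 + (b *m G *m b^T) 0 0)%:C%C.
Proof.
move=> symG; pose a := map_mx (@complex.Re R) z; pose b := map_mx (@complex.Im R) z.
exists a, b.
pose f := map_mx (real_complex R).
have zE : z = f _ _ a + 'i%C *: f _ _ b.
  by apply/rowP => i; rewrite !mxE -complexE.
have zsE : z^t* = f _ _ a^T - 'i%C *: f _ _ b^T.
  apply/colP => i; rewrite !mxE; case: (z 0 i) => x y /=.
  have -> : ((x +i* y)%C : R[i])^* = (x -i* y)%C by [].
  by apply/eqP; rewrite eq_complex /= !(mul0r, mul1r, mulr0, subr0, addr0, add0r, sub0r, oppr0, mulrN) !eqxx.
rewrite zsE [in LHS]zE -/(f _ _ G).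
have ba : b *m G *m a^T = a *m G *m b^T.
  have <- : (a *m G *m b^T)^T = b *m G *m a^T by rewrite !trmx_mul trmxK symG mulmxA.
  by apply/matrixP => i j; rewrite mxE !ord1.
rewrite mulmxDl mulmxBr !mulmxDl -!scalemxAl -!scalemxAr -!map_mxM ba.
have i2 : 'i%C * ('i%C : R[i]) = -1 by rewrite -expr2 sqr_i.
rewrite scalerA i2 scaleN1r opprD opprK addrA addrK.
by rewrite -map_mxD !mxE.
Qed.

(** The Courant-Fischer principle: a [k]-dimensional space on which the form of [A] is at least [c]
    times the squared norm forces [k] eigenvalues at least [c]. *)
Lemma count_spectrum_ge n k (A : 'M[R]_n) (c : R) (W : 'M[R]_(k, n)) :
  A^T = A -> row_free W ->
  (forall a : 'rV[R]_k, c * (a *m (W *m W^T) *m a^T) 0 0 <=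
     (a *m (W *m A *m W^T) *m a^T) 0 0) ->
  (k <= count (fun x => (c <= x)%R) (spectrum A))%N.
Proof.
move=> symA fW HW; have [U [v [uU AE /permP ->]]] := spectrum_diag symA.
rewrite count_enum_rV leqNgt; apply/negP; set S := [set i | _] => Sk.
pose f := map_mx (real_complex R).
pose Y := f _ _ W *m U^t*.
pose G := W *m A *m W^T - c *: (W *m W^T).
have symG : G^T = G.
  by rewrite /G linearB /= linearZ /= !trmx_mul trmxK symA mulmxA.
have WT : (f _ _ W)^t* = f _ _ W^T.
  by apply/matrixP => i j; rewrite !mxE -[LHS]/(conjc _) conjc_real.
have UU : U^t* *m U = 1%:M by rewrite -invmx_unitary// mulVmx ?unitarymx_unit.
have GE : f _ _ G = Y *m diag_mx (f _ _ (v - const_mx c)) *m Y^t*.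
  have -> : Y^t* = U *m f _ _ W^T by rewrite /Y trmx_mul map_mxM trmxCK WT.
  have -> : diag_mx (f _ _ (v - const_mx c)) = diag_mx (f _ _ v) - (c%:C%C)%:M.
    by apply/matrixP => i j; rewrite !mxE rmorphB mulrnBl.
  rewrite mulmxBr mulmxBl mul_mx_scalar -scalemxAl /Y.
  rewrite -!mulmxA (mulmxA (U^t*) U) UU mul1mx.
  rewrite /G /f map_mxB map_mxZ !map_mxM AE -/(f _ _ v) -/(f _ _ W) -/(f _ _ W^T).
  by rewrite -!mulmxA.
(* With fewer than [k] eigenvalues at least [c], some nonzero combination of the rows of [W] is
   orthogonal to all their eigenvectors; on it the form of [A - c] is negative. *)
have yN : exists2 z : 'rV[R[i]]_k, z != 0 & forall i, i \in S -> (z *m Y) 0 i = 0.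
  pose M := colsub (enum_val : 'I_#|S| -> 'I_n) Y.
  have : kermx M != 0.
    by rewrite kermx_eq0 /row_free neq_ltn (leq_ltn_trans (rank_leq_col _) Sk).
  case/rowV0Pn => z /sub_kermxP zM z0; exists z => // i iS.
  move/rowP/(_ (enum_rank_in iS i)): zM; rewrite mxE [RHS]mxE => H; rewrite mxE -[RHS]H.
  by apply: eq_bigr => j _; rewrite !mxE enum_rankK_in.
have [z z0 zS] := yN.
have [a [b E]] := form_complex z symG.
have E0 : 0 <= (a *m G *m a^T) 0 0 + (b *m G *m b^T) 0 0.
  have H (x : 'rV[R]_k) : 0 <= (x *m G *m x^T) 0 0.
    have := HW x; rewrite /G mulmxBr mulmxBl -scalemxAr -scalemxAl !mxE.
    by rewrite subr_ge0.
  by rewrite addr_ge0.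
have y0 : z *m Y != 0.
  rewrite mulmx_free_eq0// /row_free /Y mxrankMfree ?mxrank_map//.
  by rewrite row_free_unit -invmx_unitary// unitmx_inv unitarymx_unit.
have : (z *m f _ _ G *m z^t*) 0 0 < 0.
  rewrite GE; set y := z *m Y in y0 zS *.
  have -> : z *m (Y *m diag_mx (f _ _ (v - const_mx c)) *m Y^t*) *m z^t* =
      y *m diag_mx (f _ _ (v - const_mx c)) *m y^t*.
    by rewrite /y (trmx_mul z Y) map_mxM !mulmxA.
  have -> : (y *m diag_mx (f _ _ (v - const_mx c)) *m y^t*) 0 0 =
      \sum_i ((v 0 i - c)%:C%C * `|y 0 i| ^+ 2).
    rewrite mul_mx_diag mxE; apply: eq_bigr => i _.
    by rewrite !mxE normCK mulrAC mulrA mulrC mulrA.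
  have [i yi] : exists i, y 0 i != 0.
    by apply/existsP; apply: contraNT y0 => /existsPn H; apply/eqP/rowP => i; rewrite [RHS]mxE; have := H i; rewrite negbK => /eqP.
  have neg j : j \notin S -> ((v 0 j - c)%:C%C : R[i]) < 0.
    by rewrite inE -ltNge ltcR subr_lt0.
  rewrite (bigD1 i)//= -[ltRHS]addr0 ltr_leD//.
    rewrite nmulr_rlt0 ?exprn_gt0 ?normr_gt0//; apply: neg.
    by apply: contra yi => /zS ->.
  rewrite sumr_le0// => j _; have [jS|jS] := boolP (j \in S).
    by rewrite /y zS// normr0 expr0n mulr0.
  by rewrite nmulr_rle0 ?exprn_ge0// neg.
by rewrite E ltcR ltNge E0.
Qed.

End CountSpectrum.

(** * Adjacency matrices *)

Section AdjacencyMatrix.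
Variables (R : rcfType) (G : sgraph).
Let A : 'M[R]_#|G| := adjmx R G.

Lemma adjmx_intr : A = map_mx intr (adjmx int G).
Proof. by apply/matrixP => i j; rewrite !mxE; case: (adj _ _). Qed.

Lemma sum_enum_val (V : nmodType) (F : G -> V) : \sum_(i < #|G|) F (enum_val i) = \sum_v F v.
Proof. by rewrite [RHS](reindex (@enum_val G G)) //; apply/onW_bij/enum_val_bij. Qed.

Lemma mxtrace_adjmx : \tr A = 0.
Proof. by rewrite /mxtrace big1 // => i _; rewrite mxE adj_irrefl. Qed.

Lemma sum_adj_edges : (\sum_(u : G) \sum_(v : G) adj u v = 2 * #|edges G|)%N.
Proof.
rewrite pair_big /=.
pose f (p : G * G) : {set G} := [set p.1; p.2].
pose P := [set p : G * G | adj p.1 p.2].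
have -> : (\sum_(p : G * G) adj p.1 p.2 = #|P|)%N.
  by rewrite -sum1_card [RHS]big_mkcond; apply: eq_bigr => p _; rewrite inE; case: adj.
have -> : edges G = f @: P.
  apply/setP => e; apply/imsetP/imsetP => -[p]; rewrite !inE => pP eE; exists p; rewrite ?inE//.
rewrite -sum1_card (partition_big_imset f) /= mulnC -sum_nat_const.
apply: eq_bigr => e /imsetP[[u v] ]; rewrite inE /= => uv ->.
rewrite sum1dep_card (_ : [set _ | _] = [set (u, v); (v, u)]) ?cards2.
  by rewrite xpair_eqE; case: eqVneq uv => // ->; rewrite adj_irrefl.
apply/setP => -[x y]; rewrite !inE /f /= !xpair_eqE.
apply/andP/idP => [[xy /eqP E]|].
  have : x \in [set u; v] by rewrite -E !inE eqxx.
  have : y \in [set u; v] by rewrite -E !inE eqxx orbT.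
  rewrite !inE => /orP[]/eqP yE /orP[]/eqP xE; subst x y; rewrite ?eqxx ?orbT//;
  by rewrite adj_irrefl in xy.
by case/orP => /andP[/eqP -> /eqP ->]; rewrite ?eqxx ?uv // adj_sym uv finset.setUC.
Qed.

Lemma adjmx_formE (X : G -> R) :
  \sum_(i < #|G|) \sum_(j < #|G|) X (enum_val i) * A i j * X (enum_val j) =
  \sum_u \sum_v X u * X v * (adj u v)%:R.
Proof.
rewrite -sum_enum_val; apply: eq_bigr => i _.
by rewrite -sum_enum_val; apply: eq_bigr => j _; rewrite mxE mulrAC.
Qed.

Lemma avg_degreeE : (0 < #|G|)%N ->
  #|G|%:R * avg_degree R G = \sum_(u : G) \sum_(v : G) (adj u v)%:R.
Proof.
move=> n0; rewrite /avg_degree mulrC divfK ?pnatr_eq0 -?lt0n// -sum_adj_edges natr_sum.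
by apply: eq_bigr => u _; rewrite natr_sum.
Qed.

Lemma mxtrace_sqr_adjmx : (0 < #|G|)%N -> \tr (A *m A) = #|G|%:R * avg_degree R G.
Proof.
move=> /avg_degreeE ->; rewrite /mxtrace -sum_enum_val; apply: eq_bigr => i _.
rewrite mxE -sum_enum_val; apply: eq_bigr => j _.
by rewrite !mxE (adj_sym (enum_val j)); case: (adj _ _); rewrite ?mul1r ?mul0r.
Qed.

Lemma count_ge_fun k (x : 'I_k -> G -> R) (c : R) :
  (forall a : 'I_k -> R, (forall v, \sum_i a i * x i v = 0) -> forall i, a i = 0) ->
  (forall a : 'I_k -> R, let X v := \sum_i a i * x i v in
     c * \sum_v X v ^+ 2 <= \sum_u \sum_v X u * X v * (adj u v)%:R) ->
  (k <= count (fun y => (c <= y)%R) (spectrum A))%N.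
Proof.
move=> free form; pose W : 'M[R]_(k, #|G|) := \matrix_(i, j) x i (enum_val j).
have aW (a : 'rV[R]_k) j : (a *m W) 0 j = \sum_i a 0 i * x i (enum_val j).
  by rewrite mxE; apply: eq_bigr => i _; rewrite mxE.
apply: (@count_spectrum_ge _ _ _ _ _ W) => [||a].
- exact: adjmx_sym.
- rewrite -kermx_eq0; apply: contraT => /rowV0Pn[a /sub_kermxP aW0 a0].
  case/negP: a0; apply/eqP/rowP => i; rewrite mxE.
  apply: (free (a 0)) => v; have [j ->] : exists j : 'I_#|G|, v = enum_val j by exists (enum_rank v); rewrite enum_rankK.
  by rewrite -aW aW0 mxE.
pose X v := \sum_i a 0 i * x i v.
have E1 : (a *m (W *m W^T) *m a^T) 0 0 = \sum_v X v ^+ 2.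
  rewrite mulmxA -mulmxA -trmx_mul mxE -sum_enum_val; apply: eq_bigr => j _.
  by rewrite [(_^T) _ _]mxE aW expr2.
have E2 : (a *m (W *m A *m W^T) *m a^T) 0 0 = \sum_u \sum_v X u * X v * (adj u v)%:R.
  rewrite !mulmxA -[_ *m W^T *m _]mulmxA -trmx_mul mxE -adjmx_formE exchange_big /=.
  apply: eq_bigr => j _; rewrite mxE mulr_suml; apply: eq_bigr => i _.
  by rewrite [(_^T) _ _]mxE !aW.
by rewrite E1 E2; apply: (form (a 0)).
Qed.

(* [xs i] lists the values along [vs] of a vector supported on [vs]. *)
Lemma count_ge_list k (vs : seq G) (xs : 'I_k -> seq R) (c : R) : uniq vs ->
  (forall a : 'I_k -> R, (forall j, (j < size vs)%N -> \sum_i a i * (xs i)`_j = 0) -> forall i, a i = 0) ->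
  (forall a : 'I_k -> R, forall v0, let y j := \sum_i a i * (xs i)`_j in
     c * \sum_(0 <= j < size vs) y j ^+ 2 <=
     \sum_(0 <= j < size vs) \sum_(0 <= l < size vs) y j * y l * (adj (nth v0 vs j) (nth v0 vs l))%:R) ->
  (k <= count (fun y => (c <= y)%R) (spectrum A))%N.
Proof.
move=> uvs free form.
pose x i v := (xs i)`_(index v vs) *+ (v \in vs).
have supp (F : G -> R) : (forall v, v \notin vs -> F v = 0) -> \sum_v F v = \sum_(v <- vs) F v.
  move=> F0; rewrite (bigID (mem vs)) /= [X in _ + X]big1 ?addr0 ?big_uniq// => v /F0.
have X0 (a : 'I_k -> R) v : v \notin vs -> \sum_i a i * x i v = 0.
  by move=> /negPf vN; rewrite big1// => i _; rewrite /x vN mulr0.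
have XE (a : 'I_k -> R) v0 j : (j < size vs)%N -> \sum_i a i * x i (nth v0 vs j) = \sum_i a i * (xs i)`_j.
  by move=> jv; apply: eq_bigr => i _; rewrite /x mem_nth// index_uniq.
apply: (@count_ge_fun _ x) => [a a0|a /=].
  apply: free => j jv; case: vs {form uvs supp} x X0 XE a0 jv => // v0 vs x X0 XE a0 jv.
  by rewrite -(XE a v0 j jv) a0.
case: (posnP #|G|) => [G0|].
  have e (v : G) : False by have := card0_eq G0 v.
  by rewrite !big1 ?mulr0// => v; case: (e v).
case/card_gt0P => v0 _.
rewrite supp => [|v /X0 ->]; last by rewrite expr0n.
rewrite [leRHS]supp; last by move=> v /X0 E; apply: big1 => u _; rewrite E !mul0r.
have supp2 u : \sum_v (\sum_(i < k) a i * x i u) * (\sum_(i < k) a i * x i v) * (adj u v)%:R =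
    \sum_(v <- vs) (\sum_(i < k) a i * x i u) * (\sum_(i < k) a i * x i v) * (adj u v)%:R.
  by apply: supp => v /X0 ->; rewrite mulr0 mul0r.
under [leRHS]eq_bigr => u _ do rewrite supp2.
rewrite !(big_nth v0).
under eq_big_nat => j /andP[_ jv] do rewrite XE//.
under [leRHS]eq_big_nat => j /andP[_ jv].
  rewrite (big_nth v0).
  under eq_big_nat => l /andP[_ lv] do rewrite !XE//.
  over.
exact: form.
Qed.

End AdjacencyMatrix.

(** * Induced subgraphs that force eigenvalues *)

Section Patterns.
Variables (R : rcfType) (G : sgraph).
Implicit Types a b c d u v w x y z : G.

Definition count_eig (t : R) := count (fun e : R => t <= e) (spectrum (adjmx R G)).

Definition list_form (vs : seq G) (v0 : G) (y : nat -> R) : R :=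
  \sum_(0 <= j < size vs) \sum_(0 <= l < size vs)
    y j * y l * (adj (nth v0 vs j) (nth v0 vs l))%:R.

Lemma count_ge_list2 (vs : seq G) (xs ys : seq R) t : uniq vs ->
  (forall p q : R, (forall j, (j < size vs)%N -> p * xs`_j + q * ys`_j = 0) -> p = 0 /\ q = 0) ->
  (forall (p q : R) v0, let y j := p * xs`_j + q * ys`_j in
     t * \sum_(0 <= j < size vs) y j ^+ 2 <= list_form vs v0 y) ->
  (2 <= count_eig t)%N.
Proof.
move=> uvs free form.
apply: (@count_ge_list _ _ 2 vs (fun i => nth [::] [:: xs; ys] i)) => // [f H|f v0 /=].
  have [|p0 q0] := free (f ord0) (f (lift ord0 ord0)).
    by move=> j /H; rewrite !big_ord_recl big_ord0 addr0.
  move=> i; have := ltn_ord i; case: i => -[|[|//]] hi _.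
    by rewrite -p0; congr (f _); apply: val_inj.
  by rewrite -q0; congr (f _); apply: val_inj.
have := form (f ord0) (f (lift ord0 ord0)) v0; rewrite /= /list_form.
have E j : \sum_(i < 2) f i * (nth [::] [:: xs; ys] i)`_j = f ord0 * xs`_j + f (lift ord0 ord0) * ys`_j.
  by rewrite !big_ord_recl big_ord0 addr0.
under [X in _ -> _ * X <= _]eq_bigr => j _ do rewrite E.
under [X in _ -> _ <= X]eq_bigr => j _ do under eq_bigr => l _ do rewrite !E.
by [].
Qed.

Lemma count_ge_list3 (vs : seq G) (xs ys zs : seq R) t : uniq vs ->
  (forall p q r : R, (forall j, (j < size vs)%N -> p * xs`_j + q * ys`_j + r * zs`_j = 0) ->
     [/\ p = 0, q = 0 & r = 0]) ->
  (forall (p q r : R) v0, let y j := p * xs`_j + q * ys`_j + r * zs`_j in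
     t * \sum_(0 <= j < size vs) y j ^+ 2 <= list_form vs v0 y) ->
  (3 <= count_eig t)%N.
Proof.
move=> uvs free form; pose i1 : 'I_3 := lift ord0 ord0; pose i2 : 'I_3 := lift ord0 (lift ord0 ord0).
have E (f : 'I_3 -> R) j : \sum_(i < 3) f i * (nth [::] [:: xs; ys; zs] i)`_j =
    f ord0 * xs`_j + f i1 * ys`_j + f i2 * zs`_j.
  by rewrite !big_ord_recl big_ord0 addr0 addrA.
apply: (@count_ge_list _ _ 3 vs (fun i => nth [::] [:: xs; ys; zs] i)) => // [f H|f v0 /=].
  have [|p0 q0 r0] := free (f ord0) (f i1) (f i2).
    by move=> j /H; rewrite E.
  move=> i; have := ltn_ord i; case: i => -[|[|[|//]]] hi _.
  - by rewrite -p0; congr (f _); apply: val_inj.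
  - by rewrite -q0; congr (f _); apply: val_inj.
  - by rewrite -r0; congr (f _); apply: val_inj.
have := form (f ord0) (f i1) (f i2) v0; rewrite /= /list_form.
under [X in _ -> _ * X <= _]eq_bigr => j _ do rewrite E.
under [X in _ -> _ <= X]eq_bigr => j _ do under eq_bigr => l _ do rewrite !E.
by [].
Qed.

Lemma adj_neq u v : adj u v -> u != v.
Proof. by apply: contraTneq => ->; rewrite adj_irrefl. Qed.

Definition is_P4 a b c d := [&& adj a b, adj b c, adj c d, ~~ adj a c, ~~ adj b d & ~~ adj a d].
Definition is_2K2 a b c d := [&& adj a b, adj c d, ~~ adj a c, ~~ adj a d, ~~ adj b c & ~~ adj b d].
Definition is_paw c z k l := [&& adj c z, adj z k, adj z l, adj k l, ~~ adj c k & ~~ adj c l].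

Lemma P4E a b c d : is_P4 a b c d ->
  ((adj a b = true) * (adj b a = true) * (adj b c = true) * (adj c b = true)) *
  ((adj c d = true) * (adj d c = true) * (adj a c = false) * (adj c a = false)) *
  ((adj b d = false) * (adj d b = false) * (adj a d = false) * (adj d a = false)) *
  ((adj a a = false) * (adj b b = false) * (adj c c = false) * (adj d d = false)).
Proof.
case/and4P => ab bc cd /and3P[/negPf ac /negPf bd /negPf ad].
by rewrite !(adj_sym b a) !(adj_sym c b) !(adj_sym d c) !(adj_sym c a) !(adj_sym d b) !(adj_sym d a) !adj_irrefl.
Qed.

Lemma pawE c z k l : is_paw c z k l ->
  ((adj c z = true) * (adj z c = true) * (adj z k = true) * (adj k z = true)) *
  ((adj z l = true) * (adj l z = true) * (adj k l = true) * (adj l k = true)) *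
  ((adj c k = false) * (adj k c = false) * (adj c l = false) * (adj l c = false)) *
  ((adj c c = false) * (adj z z = false) * (adj k k = false) * (adj l l = false)).
Proof.
case/and4P => cz zk zl /and3P[kl /negPf ck /negPf cl].
by rewrite !(adj_sym z c) !(adj_sym k z) !(adj_sym l z) !(adj_sym l k) !(adj_sym k c) !(adj_sym l c) !adj_irrefl.
Qed.

Ltac uniq_tac := rewrite /= ?inE ?negb_or; repeat (apply/andP; split); rewrite ?andbT //;
  apply/eqP => EE; subst; congruence.

Lemma P4_uniq a b c d : is_P4 a b c d -> uniq [:: a; b; c; d].
Proof. move=> /P4E[[[[[[? ?] ?] ?] [[[? ?] ?] ?]] [[[? ?] ?] ?]] [[[? ?] ?] ?]]; uniq_tac. Qed.

Lemma paw_uniq c z k l : is_paw c z k l -> uniq [:: c; z; k; l].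
Proof. move=> /pawE[[[[[[? ?] ?] ?] [[[? ?] ?] ?]] [[[? ?] ?] ?]] [[[? ?] ?] ?]]; uniq_tac. Qed.

Lemma P4_count_eig a b c d : is_P4 a b c d -> (2 <= count_eig (1 / 2))%N.
Proof.
move=> H; apply: (@count_ge_list2 [:: a; b; c; d] [:: 1; 1; 0; 0] [:: 0; 0; 1; 1]).
- exact: P4_uniq.
- move=> p q E; have := E 0%N isT; have := E 2%N isT; rewrite /=; lra.
move=> p q v0 /=; rewrite /list_form unlock /= !(P4E H) /=.
rewrite -subr_ge0 (_ : _ - _ = (p + q) ^+ 2) ?sqr_ge0//; by field.
Qed.

(** Only positivity of the constant matters later; the second eigenvalue of the paw is about
    0.31. *)
Lemma paw_count_eig c z k l : is_paw c z k l -> (2 <= count_eig (1 / 10))%N.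
Proof.
move=> H; apply: (@count_ge_list2 [:: c; z; k; l] [:: 1; 1/2; 0; 0] [:: 0; 0; 1; 1]).
- exact: paw_uniq.
- move=> p q E; have := E 0%N isT; have := E 2%N isT; rewrite /=; lra.
move=> p q v0 /=; rewrite /list_form unlock /= !(pawE H) /=.
rewrite -subr_ge0 (_ : _ - _ = (7/8) * (p + (8/7) * q) ^+ 2 + (23/35) * q ^+ 2); last by field.
by rewrite addr_ge0// mulr_ge0// ?sqr_ge0//; lra.
Qed.

Lemma two_K2_count_eig a b c d : is_2K2 a b c d -> (2 <= count_eig 1)%N.
Proof.
case/and3P => ab cd /and4P[/negPf ac /negPf ad /negPf bc /negPf bd].
have ba : adj b a by rewrite adj_sym.
have dc : adj d c by rewrite adj_sym.
have [ca da cb db] : [/\ adj c a = false, adj d a = false, adj c b = false & adj d b = false].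
  by rewrite !(adj_sym c) !(adj_sym d).
apply: (@count_ge_list2 [:: a; b; c; d] [:: 1; 1; 0; 0] [:: 0; 0; 1; 1]).
- have := (adj_irrefl a, adj_irrefl c, adj_irrefl b, adj_irrefl d) => -[[[? ?] ?] ?]; uniq_tac.
- move=> p q E; have := E 0%N isT; have := E 2%N isT; rewrite /=; lra.
move=> p q v0 /=; rewrite /list_form unlock /= ab ba cd dc ac ca ad da bc cb bd db !adj_irrefl /=.
by rewrite -subr_ge0 (_ : _ - _ = p ^+ 2 *+ 0) ?mulr0n//; ring.
Qed.

(* The third vector is [v] minus its [A]-orthogonal projection on the span of
   [a, b, c, d]; likewise in [paw_extend]. *)
Lemma P4_extend a b c d v : is_P4 a b c d -> v \notin [:: a; b; c; d] ->
  (adj v a * adj v b + adj v c * adj v d <= adj v a * adj v d)%N -> (3 <= count_eig 0)%N.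
Proof.
move=> H vN; rewrite -(ler_nat R) natrD !natrM.
have := (adj_sym a v, adj_sym b v, adj_sym c v, adj_sym d v).
set xa : R := (adj v a)%:R; set xb : R := (adj v b)%:R.
set xc : R := (adj v c)%:R; set xd : R := (adj v d)%:R => E q0.
apply: (@count_ge_list3 [:: a; b; c; d; v] [:: 1; 1; 0; 0; 0] [:: 0; 0; 1; 1; 0]
  [:: xd - xb; - xa; - xd; xa - xc; 1]).
- by rewrite (_ : [:: _; _; _; _; v] = rcons [:: a; b; c; d] v)// rcons_uniq vN P4_uniq.
- move=> p q r F; have := F 4%N isT; have := F 0%N isT; have := F 2%N isT; rewrite /=.
  rewrite !mulr0 !add0r !addr0 !mulr1 => F2 F0 r0; rewrite r0 !mul0r !addr0 in F2 F0 *.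
  by split.
move=> p q r v0 /=; rewrite /list_form unlock /= !(P4E H) !E adj_irrefl -/xa -/xb -/xc -/xd /=.
rewrite mul0r.
rewrite [leRHS](_ : _ = p ^+ 2 + q ^+ 2 + (p + q) ^+ 2 + 2 * r ^+ 2 * (xa * xd - (xa * xb + xc * xd))).
  by rewrite addr_ge0 ?addr_ge0 ?sqr_ge0// mulr_ge0 ?subr_ge0// mulr_ge0 ?sqr_ge0.
by ring.
Qed.

(** As [v] and [w] can differ only at [d] among the four vertices, adding [x - y] times [a - c] to
    [v - w] makes it [A]-orthogonal to the path. The form vanishes on the result because [v] and [w]
    are not adjacent. *)
Lemma P4_twins a b c d v w : is_P4 a b c d -> v \notin [:: a; b; c; d] -> w \notin [:: a; b; c; d] ->
  v != w -> [&& adj v a, adj v b & adj v c] -> [&& adj w a, adj w b & adj w c] -> ~~ adj v w ->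
  (3 <= count_eig 0)%N.
Proof.
move=> H vN wN vw /and3P[va vb vc] /and3P[wa wb wc] /negPf vwN.
have := (adj_sym a v, adj_sym b v, adj_sym c v, adj_sym d v, adj_sym w v).
have := (adj_sym a w, adj_sym b w, adj_sym c w, adj_sym d w).
set x : R := (adj v d)%:R; set y : R := (adj w d)%:R => E1 E2.
apply: (@count_ge_list3 [:: a; b; c; d; v; w] [:: 1; 1; 0; 0; 0; 0] [:: 0; 0; 1; 1; 0; 0]
  [:: x - y; 0; y - x; 0; 1; -1]).
- rewrite (_ : [:: _; _; _; _; v; w] = rcons (rcons [:: a; b; c; d] v) w)//.
  by rewrite !rcons_uniq mem_rcons inE negb_or eq_sym vw wN vN P4_uniq.
- move=> p q r F; have := F 4%N isT; have := F 1%N isT; have := F 3%N isT; rewrite /=.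
  by rewrite !mulr0 !add0r !addr0 !mulr1 => F2 F0 r0.
move=> p q r v0 /=; rewrite /list_form unlock /= !(P4E H) !E1 !E2 va vb vc wa wb wc vwN !adj_irrefl -/x -/y /=.
rewrite mul0r.
rewrite [leRHS](_ : _ = p ^+ 2 + q ^+ 2 + (p + q) ^+ 2).
  by rewrite ?addr_ge0 ?sqr_ge0.
by ring.
Qed.

Lemma paw_extend c z k l v : is_paw c z k l -> v \notin [:: c; z; k; l] ->
  (adj v c + adj v c * adj v z + adj v k * adj v l <= adj v c * adj v k + adj v c * adj v l)%N ->
  (3 <= count_eig 0)%N.
Proof.
move=> H vN; rewrite -(ler_nat R) !natrD !natrM.
have := (adj_sym c v, adj_sym z v, adj_sym k v, adj_sym l v).
set yc : R := (adj v c)%:R; set yz : R := (adj v z)%:R.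
set y1 : R := (adj v k)%:R; set y2 : R := (adj v l)%:R => E q0.
have yc2 : yc ^+ 2 = yc by rewrite /yc; case: adj; rewrite ?expr1n ?expr0n.
apply: (@count_ge_list3 [:: c; z; k; l; v] [:: 2; 1; 0; 0; 0] [:: 0; 0; 1; 1; 0]
  [:: y1 + y2 - yz - 2 * yc; - yc; yc - y2; yc - y1; 1]).
- by rewrite (_ : [:: _; _; _; _; v] = rcons [:: c; z; k; l] v)// rcons_uniq vN paw_uniq.
- move=> p q r F; have := F 4%N isT; have := F 1%N isT; have := F 2%N isT; rewrite /=.
  rewrite !mulr0 !add0r !addr0 !mulr1 => F2 F0 r0; rewrite r0 !mul0r !addr0 in F2 F0 *.
  by split.
move=> p q r v0 /=; rewrite /list_form unlock /= !(pawE H) !E adj_irrefl -/yc -/yz -/y1 -/y2 /=.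
rewrite mul0r.
rewrite [leRHS](_ : _ = 2 * p ^+ 2 + 2 * (p + q) ^+ 2 +
  2 * r ^+ 2 * (yc * y1 + yc * y2 - (yc ^+ 2 + yc * yz + y1 * y2))); last by ring.
have S : 0 <= yc * y1 + yc * y2 - (yc ^+ 2 + yc * yz + y1 * y2) by rewrite yc2 subr_ge0.
by have := sqr_ge0 p; have := sqr_ge0 (p + q); have := mulr_ge0 (sqr_ge0 r) S; lra.
Qed.

(** Now [v - w] itself is [A]-orthogonal to the paw, and the form vanishes on it. *)
Lemma paw_twins c z k l v w : is_paw c z k l -> v \notin [:: c; z; k; l] -> w \notin [:: c; z; k; l] ->
  v != w -> adj v c = adj w c -> adj v z = adj w z -> adj v k = adj w k -> adj v l = adj w l ->
  ~~ adj v w -> (3 <= count_eig 0)%N.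
Proof.
move=> H vN wN vw E1 E2 E3 E4 /negPf vwN.
have E5 := (adj_sym c v, adj_sym z v, adj_sym k v, adj_sym l v, adj_sym w v).
have E6 := (adj_sym c w, adj_sym z w, adj_sym k w, adj_sym l w).
apply: (@count_ge_list3 [:: c; z; k; l; v; w] [:: 2; 1; 0; 0; 0; 0] [:: 0; 0; 1; 1; 0; 0]
  [:: 0; 0; 0; 0; 1; -1]).
- rewrite (_ : [:: _; _; _; _; v; w] = rcons (rcons [:: c; z; k; l] v) w)//.
  by rewrite !rcons_uniq mem_rcons inE negb_or eq_sym vw wN vN paw_uniq.
- move=> p q r F; have := F 4%N isT; have := F 1%N isT; have := F 3%N isT; rewrite /=.
  by rewrite !mulr0 !add0r !addr0 !mulr1 => F2 F0 r0.
move=> p q r v0 /=; rewrite /list_form unlock /= !(pawE H) !E5 !E6 vwN !adj_irrefl E1 E2 E3 E4 /=.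
rewrite mul0r.
rewrite [leRHS](_ : _ = 2 * p ^+ 2 + 2 * (p + q) ^+ 2); last by ring.
by have := sqr_ge0 p; have := sqr_ge0 (p + q); lra.
Qed.

(** The complement of this graph on six vertices is a double star with centres [a] and [d]. The
    second test vector is an eigenvector for the eigenvalue 1, orthogonal to the all-ones vector. *)
Lemma double_star_count_eig a b c d x y : is_P4 a b c d ->
  [&& adj x a, adj x b, adj x c & ~~ adj x d] -> [&& adj y d, adj y c, adj y b & ~~ adj y a] ->
  adj x y -> (2 <= count_eig 1)%N.
Proof.
move=> H /and4P[xa xb xc /negPf xd] /and4P[yd yc yb /negPf ya] xy.
have E5 := (adj_sym a x, adj_sym b x, adj_sym c x, adj_sym d x, adj_sym y x).
have E6 := (adj_sym a y, adj_sym b y, adj_sym c y, adj_sym d y).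
apply: (@count_ge_list2 [:: a; b; c; d; x; y] [:: 1; 1; 1; 1; 1; 1] [:: 2; 1; -1; -2; 1; -1]).
- move: H E5 E6 => /P4E[[[[[[? ?] ?] ?] [[[? ?] ?] ?]] [[[? ?] ?] ?]] [[[? ?] ?] ?]].
  by move=> [[[[? ?] ?] ?] ?] [[[? ?] ?] ?]; uniq_tac.
- move=> p q F; have := F 0%N isT; have := F 1%N isT; rewrite /=; lra.
move=> p q v0 /=; rewrite /list_form unlock /= !(P4E H) !E5 !E6 xa xb xc xd ya yb yc yd xy !adj_irrefl /=.
rewrite -subr_ge0 (_ : _ - _ = 14 * p ^+ 2); last by ring.
by rewrite mulr_ge0 ?sqr_ge0.
Qed.

End Patterns.

(** * Divisors of the determinant *)

Section Determinant.
Variables (R : rcfType) (G : sgraph).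
Implicit Types a b c d u v w x y z : G.
Local Notation count_eig := (@count_eig R G).

Lemma dvd_det_adjmx (M : int) (f g : G -> int) v0 :
  (forall u, \sum_v (adj u v)%:R * f v = M * g u) -> f v0 = 1 -> (M %| \det (adjmx int G))%Z.
Proof.
move=> fg f1; apply: (@dvd_det _ _ (\col_i f (enum_val i)) (\col_i g (enum_val i)) _ (enum_rank v0)).
  apply/colP => i; rewrite !mxE -fg -sum_enum_val; apply: eq_bigr => j _.
  by rewrite !mxE.
by rewrite mxE enum_rankK.
Qed.

Lemma dvd_le_prod_spectrum (M : nat) : 0 \notin spectrum (adjmx R G) ->
  (M%:Z %| \det (adjmx int G))%Z -> M%:R <= \prod_(x <- spectrum (adjmx R G)) `|x|.
Proof.
move=> s0 Md; have E := norm_det_spectrum (adjmx_sym R G).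
have D0 : \det (adjmx R G) != 0.
  rewrite -normr_eq0 -E prodf_seq_neq0; apply/allP => x xs /=; rewrite normr_eq0.
  by apply: contraNneq s0 => <-.
rewrite E adjmx_intr det_map_mx -intr_norm; rewrite adjmx_intr det_map_mx intr_eq0 in D0.
rewrite -[M%:R]/(M%:Z%:~R) ler_int -[`|_|]abszE lez_nat; apply: dvdn_leq.
  by rewrite absz_gt0.
by move: Md; rewrite /dvdz.
Qed.

Lemma sum_delta (F : G -> int) x : \sum_v F v * (v == x)%:R = F x.
Proof. by rewrite (bigD1 x)//= eqxx mulr1 big1 ?addr0// => v /negPf ->; rewrite mulr0. Qed.

Lemma sum_one : \sum_(v : G) 1 = #|G|%:R :> int.
Proof. by rewrite sumr_const. Qed.

(** By [P4_twins] the vertices outside the path are pairwise adjacent, so the graph without [d] is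
    complete minus the edge [ac]; only the neighbourhood of [d] is free. The coefficient [t] below
    is chosen to make row [d] of the product vanish. *)
Lemma P4_dvd_det a b c d : is_P4 a b c d -> ~~ (3 <= count_eig 0)%N ->
  (forall v, v \notin [:: a; b; c; d] -> [&& adj v a, adj v b & adj v c]) ->
  (#|G|%:R - 3%:R %| \det (adjmx int G))%Z.
Proof.
move=> H cnt T.
have /and4P[] := P4_uniq H; rewrite !inE !negb_or => /and3P[ab ac ad] /andP[bc bd] cd _.
have adjE u v : u != d -> v != d ->
  adj u v = [&& u != v, ~~ ((u == a) && (v == c)) & ~~ ((u == c) && (v == a))].
  move=> ud vd; have [->|uv] := eqVneq u v; first by rewrite adj_irrefl.
  have [uN|] := boolP (u \notin [:: a; b; c; d]); last rewrite negbK => uL.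
    have /and3P[ua ub uc] := T u uN.
    have [vN|] := boolP (v \notin [:: a; b; c; d]); last rewrite negbK => vL.
      have -> : adj u v.
        by apply: contraT => uvN; case/negP: cnt; apply: P4_twins H uN vN uv (T _ uN) (T _ vN) uvN.
      by move: uN; rewrite !inE !negb_or => /and4P[/negPf -> _ /negPf -> _].
    move: uN vL; rewrite !inE !negb_or (negPf vd) orbF => /and4P[/negPf -> _ /negPf -> _].
    by case/or3P => /eqP ->; rewrite ?ua ?ub ?uc.
  have [vN|] := boolP (v \notin [:: a; b; c; d]); last rewrite negbK => vL.
    have /and3P[va vb vc] := T v vN; rewrite adj_sym.
    move: vN uL; rewrite !inE !negb_or (negPf ud) orbF => /and4P[/negPf -> _ /negPf -> _].
    by rewrite !andbF; case/or3P => /eqP ->; rewrite ?va ?vb ?vc.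
  move: uv uL vL; rewrite !inE (negPf ud) (negPf vd) !orbF.
  have [ba ca cb] : [/\ (b == a) = false, (c == a) = false & (c == b) = false].
    by rewrite ![_ == a]eq_sym [c == b]eq_sym (negPf ab) (negPf ac) (negPf bc).
  move=> uv; case/or3P => /eqP uE; case/or3P => /eqP vE; subst u v; rewrite ?eqxx in uv => //;
  by rewrite ?(P4E H) ?eqxx ?(negPf ab) ?(negPf ac) ?(negPf bc) ?ba ?ca ?cb.
(* The adjacency matrix maps [f] to [n - 3] times the indicator of [u != d]. *)
pose t : int := \sum_v (adj d v)%:R - 1.
pose f v : int := 1 + t * (v == a)%:R - (1 + t) * (v == c)%:R - (v == d)%:R.
apply: (@dvd_det_adjmx _ f (fun u => (u != d)%:R) b); last first.
  by rewrite /f [b == a]eq_sym (negPf ab) (negPf bc) (negPf bd) /=; ring.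
move=> u; rewrite /f.
rewrite (_ : \sum_v _ = \sum_v (adj u v)%:R + t * (adj u a)%:R - (1 + t) * (adj u c)%:R - (adj u d)%:R).
  have [->|ud] := eqVneq u d; first by rewrite !(P4E H) /= /t; ring.
  have Dg : \sum_v (adj u v)%:R = #|G|%:R - 1 - (u == a)%:R - (u == c)%:R - (1 - (adj u d)%:R) :> int.
    transitivity (\sum_(v : G) 1 - \sum_v 1 * (v == u)%:R - \sum_v (u == a)%:R * (v == c)%:R
      - \sum_v (u == c)%:R * (v == a)%:R - \sum_v (1 - (adj u d)%:R) * (v == d)%:R : int); last first.
      by rewrite !sum_delta sum_one.
    rewrite -!sumrB; apply: eq_bigr => v _; case: (eqVneq v d) => [->|vd].
      by rewrite [d == u]eq_sym [d == c]eq_sym [d == a]eq_sym (negPf ud) (negPf cd) (negPf ad) /=; ring.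
    rewrite adjE// (eq_sym v u); case: (eqVneq u v) => [<-|uv] /=.
      by case: (eqVneq u a) => [->|_]; rewrite ?(negPf ac) /=; case: (u == c) => /=; ring.
    case: (eqVneq u a) => [->|_]; rewrite ?(negPf ac) /=.
      by case: (v == c) => /=; ring.
    by case: (u == c) => /=; case: (v == a) => /=; ring.
  rewrite Dg (adjE u a ud ad) (adjE u c ud cd) !eqxx [a == c](negPf ac) [c == a]eq_sym (negPf ac) /=.
  case: (eqVneq u a) => [->|_]; rewrite ?(negPf ac) /=; first by ring.
  by case: (u == c) => /=; ring.
rewrite -(sum_delta (fun v => (adj u v)%:R) a) -(sum_delta (fun v => (adj u v)%:R) c).
rewrite -(sum_delta (fun v => (adj u v)%:R) d) !mulr_sumr -big_split -!sumrB /=.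
by apply: eq_bigr => v _; ring.
Qed.

(** Without [c] the graph is complete. The adjacency matrix maps [c] plus its neighbours to [t]
    times the all-ones vector, and the non-neighbours other than [c], minus [c], to [n - 2 - t]
    times the indicator of [u != c]. The vertices [z] and [k] serve as entries equal to 1. *)
Lemma clique_cover_dvd_det c z k : (forall u v, u != c -> v != c -> u != v -> adj u v) ->
  adj c z -> k != c -> ~~ adj c k ->
  let t := \sum_v (adj c v)%:R in
  (t %| \det (adjmx int G))%Z /\ (#|G|%:R - 2 - t %| \det (adjmx int G))%Z.
Proof.
move=> K cz kc /negPf ck t.
have adjE u v : u != c -> v != c -> adj u v = (v != u).
  by move=> uc vc; have [->|uv] := eqVneq v u; rewrite ?adj_irrefl ?K// eq_sym.
have common u : \sum_v (adj u v)%:R * (adj c v)%:R = t - (if u == c then 0 else (adj c u)%:R) :> int.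
  case: eqVneq => [->|uc].
    by rewrite subr0; apply: eq_bigr => v _; case: adj; rewrite ?mulr0 ?mulr1.
  transitivity (t - \sum_v (adj c v)%:R * (v == u)%:R : int); last by rewrite sum_delta.
  rewrite -sumrB; apply: eq_bigr => v _; case: (eqVneq v c) => [->|vc].
    by rewrite adj_irrefl /= mulr0 mul0r.
  by rewrite adjE//; case: (v == u); case: (adj c v).
have Dg u : u != c -> \sum_v (adj u v)%:R = #|G|%:R - 2 + (adj c u)%:R :> int.
  move=> uc; transitivity (\sum_(v : G) 1 - \sum_v 1 * (v == u)%:R
    - \sum_v (1 - (adj c u)%:R) * (v == c)%:R : int); last by rewrite !sum_delta sum_one; ring.
  rewrite -!sumrB; apply: eq_bigr => v _; case: (eqVneq v c) => [->|vc].
    by rewrite eq_sym (negPf uc) adj_sym /=; ring.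
  by rewrite adjE//; case: (v == u) => /=; ring.
have zc : z != c by rewrite eq_sym; exact: adj_neq.
split.
  apply: (@dvd_det_adjmx _ (fun v => (v == c)%:R + (adj c v)%:R) (fun=> 1) z); last by rewrite (negPf zc) cz.
  move=> u; under eq_bigr => v _ do rewrite mulrDr.
  rewrite big_split /= sum_delta common adj_sym mulr1.
  by case: eqVneq => [->|_]; rewrite ?adj_irrefl /=; ring.
apply: (@dvd_det_adjmx _ (fun v => 1 - (adj c v)%:R - 2 * (v == c)%:R) (fun u => (u != c)%:R) k); last first.
  by rewrite (negPf kc) ck.
move=> u; transitivity (\sum_v (adj u v)%:R - \sum_v (adj u v)%:R * (adj c v)%:R
    - \sum_v (2 * (adj u v)%:R) * (v == c)%:R : int).
  by rewrite -!sumrB; apply: eq_bigr => v _; ring.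
rewrite sum_delta common; have [->|uc] := eqVneq u c.
  by rewrite adj_irrefl /= /t; ring.
by rewrite Dg// (adj_sym u) /=; ring.
Qed.

Lemma det_alternative : (5 <= #|G|)%N -> ~~ (3 <= count_eig 0)%N -> 0 \notin spectrum (adjmx R G) ->
  (exists a b c d, [|| is_2K2 a b c d, is_P4 a b c d | is_paw a b c d]) ->
  (2 <= count_eig 1)%N \/
  exists2 D : R, D <= \prod_(x <- spectrum (adjmx R G)) `|x| & 3 <= D \/ 2 <= D /\ (#|G| <= 6)%N.
Proof.
move=> n5 cnt s0 pat.
have [/existsP[a /existsP[b /existsP[c /existsP[d H]]]]|/existsPn noK2] :=
  boolP [exists a : G, exists b : G, exists c : G, exists d : G, is_2K2 a b c d].
  by left; exact: two_K2_count_eig H.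
have {}noK2 a b c d : is_2K2 a b c d = false.
  by apply/negbTE; have /existsPn/(_ b)/existsPn/(_ c)/existsPn/(_ d) := noK2 a.
have [/existsP[a /existsP[b /existsP[c /existsP[d H]]]]|/existsPn noP4] :=
  boolP [exists a : G, exists b : G, exists c : G, exists d : G, is_P4 a b c d].
  (* Having no third nonnegative eigenvalue excludes the adjacencies of [P4_extend]; excluding 2K2
     as well leaves three types of vertices. *)
  have types v : v \notin [:: a; b; c; d] ->
      [&& adj v b, adj v c & adj v a || adj v d].
    move=> vN; have := contra (@P4_extend R _ _ _ _ _ _ H vN) cnt.
    move: (noK2 a v c d) (noK2 a b d v).
    by rewrite /is_2K2 !(P4E H) ?(adj_sym a v) ?(adj_sym b v) ?(adj_sym c v) ?(adj_sym d v);
      case: (adj v a); case: (adj v b); case: (adj v c); case: (adj v d).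
  have dvd a' b' c' d' : is_P4 a' b' c' d' ->
      (forall v, v \notin [:: a'; b'; c'; d'] -> [&& adj v a', adj v b' & adj v c']) ->
      exists2 D : R, D <= \prod_(x <- spectrum (adjmx R G)) `|x| & 3 <= D \/ 2 <= D /\ (#|G| <= 6)%N.
    move=> H' T; exists (#|G| - 3)%:R.
      by apply: dvd_le_prod_spectrum => //; rewrite -natz natrB ?(leq_trans _ n5)//; exact: P4_dvd_det H' cnt T.
    by rewrite !ler_nat; case: (ltnP 5 #|G|) => n6; [left|right]; lia.
  (* If some [x] misses [d] and some [y] misses [a], they form with the path a graph with second
     eigenvalue at least 1, or an induced 2K2. Otherwise, up to reversing the path, [P4_dvd_det]
     applies. *)
  have [/existsP[x /andP[xN /negP xd]]|/existsPn Td] :=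
    boolP [exists x : G, (x \notin [:: a; b; c; d]) && ~~ adj x d].
    have [/existsP[y /andP[yN /negP ya]]|/existsPn Ta] :=
      boolP [exists y : G, (y \notin [:: a; b; c; d]) && ~~ adj y a].
      have /and3P[xb xc] := types x xN; have /and3P[yb yc] := types y yN.
      move: xd ya => /negP /negPf xd /negP /negPf ya; rewrite xd ya orbF /= => yd xa.
      have [xy|xy] := boolP (adj x y).
        by left; apply: double_star_count_eig H _ _ xy; rewrite ?xa ?xb ?xc ?xd ?ya ?yb ?yc ?yd.
      by have := noK2 x a y d; rewrite /is_2K2 xa yd xy xd (adj_sym a y) ya (P4E H).
    right; apply: dvd H _ => v vN; have /and3P[-> -> _] := types v vN.
    by have := Ta v; rewrite vN negbK => ->.
  have H' : is_P4 d c b a by rewrite /is_P4 !(P4E H).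
  right; apply: dvd H' _ => v vN.
  have vN' : v \notin [:: a; b; c; d].
    by move: vN; rewrite !inE !negb_or => /and4P[-> -> -> ->].
  have /and3P[-> -> _] := types v vN'.
  by have := Td v; rewrite vN' negbK => ->.
have {}noP4 a b c d : is_P4 a b c d = false.
  by apply/negbTE; have /existsPn/(_ b)/existsPn/(_ c)/existsPn/(_ d) := noP4 a.
right; case: pat => c [z [k [l]]]; rewrite noK2 noP4 /= => H.
have types v : v \notin [:: c; z; k; l] -> [&& adj v z, adj v k & adj v l].
  move=> vN; have := contra (@paw_extend R _ _ _ _ _ _ H vN) cnt.
  move: (noK2 c v k l) (noP4 c z k v) (noP4 c v k l) (noP4 c v l k).
  by rewrite /is_2K2 /is_P4 !(pawE H) ?(adj_sym c v) ?(adj_sym z v) ?(adj_sym k v) ?(adj_sym l v);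
    case: (adj v c); case: (adj v z); case: (adj v k); case: (adj v l).
have K u v : u != c -> v != c -> u != v -> adj u v.
  move=> uc vc uv.
  have [uN|] := boolP (u \notin [:: c; z; k; l]); last rewrite negbK => uL.
    have /and3P[uz uk ul] := types u uN.
    have [vN|] := boolP (v \notin [:: c; z; k; l]); last rewrite negbK => vL.
      have /and3P[vz vk vl] := types v vN.
      apply: contraT => uvN; have [/eqP E|] := boolP (adj u c == adj v c).
        by case/negP: cnt; apply: paw_twins H uN vN uv E _ _ _ uvN; rewrite ?uz ?uk ?ul.
      move: (noP4 c u k v) (noP4 c v k u).
      rewrite /is_P4 !(pawE H) !(adj_sym c) !(adj_sym k) (adj_sym v u) uk vk (negPf uvN).
      by case: (adj u c); case: (adj v c).
    by move: vL; rewrite !inE (negPf vc) /= => /or3P[]/eqP ->.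
  have [vN|] := boolP (v \notin [:: c; z; k; l]); last rewrite negbK => vL.
    have /and3P[vz vk vl] := types v vN; rewrite adj_sym.
    by move: uL; rewrite !inE (negPf uc) /= => /or3P[]/eqP ->.
  move: uv uL vL; rewrite !inE (negPf uc) (negPf vc) /= => uv /or3P[]/eqP uE /or3P[]/eqP vE;
  by subst u v; rewrite ?eqxx in uv => //; rewrite (pawE H).
have kc : k != c.
  by rewrite eq_sym; have /and4P[] := paw_uniq H; rewrite !inE !negb_or => /and3P[].
have [] := @clique_cover_dvd_det c z k K; rewrite ?(pawE H)//.
set t : nat := (\sum_v adj c v)%N.
have -> : \sum_v (adj c v)%:R = t%:Z by rewrite -natz /t natr_sum.
move=> D1 D2.
have tn : (t + 2 <= #|G|)%N.
  have E x : (\sum_v (v == x) = 1)%N.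
    by rewrite (bigD1 x)//= eqxx big1// => v /negPf ->.
  rewrite (_ : 2 = 1 + 1)%N// -[X in (_ + (X + _))%N](E c) -(E k) -!big_split -sum1_card /=.
  apply: leq_sum => v _; case: (eqVneq v c) => [->|_]; first by rewrite adj_irrefl eq_sym (negPf kc).
  by case: (eqVneq v k) => [->|_]; rewrite ?(pawE H)//; case: adj.
(* Take the larger of two divisors with sum [n - 2]: it is at least 3 if [n >= 7], and at least 2 in
   any case. *)
case: (leqP t (#|G| - 2 - t)) => th.
  exists (#|G| - 2 - t)%:R; last by rewrite !ler_nat; case: (ltnP 6 #|G|) => n6; [left|right]; lia.
  apply: dvd_le_prod_spectrum => //.
  by rewrite (_ : Posz _ = #|G|%:R - 2 - t%:Z)// natz; lia.
exists t%:R; last by rewrite !ler_nat; case: (ltnP 6 #|G|) => n6; [left|right]; lia.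
exact: dvd_le_prod_spectrum.
Qed.

End Determinant.

(** * The energy of a graph *)

Lemma sorted_count_nth (R : realDomainType) (s : seq R) (k : nat) (c : R) : sorted >=%R s ->
  (k < count (fun e => (c <= e)%R) s)%N -> c <= s`_k.
Proof.
elim: s k => //= x s IHs k; rewrite path_sortedE => [/andP[xs ss]|]; last exact: rev_trans le_trans.
case: k => [|k] /=; last first.
  by move=> H; apply: IHs => //; case: (c <= x) H => //= /ltnW.
case: leP => // xc; rewrite (eq_in_count (a2 := pred0)) ?count_pred0// => y /(allP xs) /= yx.
by apply/negbTE; rewrite -ltNge; apply: le_lt_trans xc.
Qed.

Section Energy.
Variables (R : realType) (G : sgraph).
Local Notation A := (adjmx R G).
Local Notation sp := (spectrum A).
Local Notation d := (avg_degree R G).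
Local Notation n := #|G|.
Local Notation count_eig := (@count_eig R G).
Local Notation nz := (fun e : R => e != 0).

Lemma count_eig_avg_degree : (0 < n)%N -> (1 <= count_eig d)%N.
Proof.
move=> n0; apply: (@count_ge_fun _ _ 1 (fun _ _ => 1)) => [a H i|a /=].
  case/card_gt0P: n0 => v _; move: (H v); rewrite big_ord1 mulr1 => <-.
  by congr (a _); rewrite ord1 [RHS]ord1.
rewrite big_ord1 mulr1 sumr_const mulrnAr -mulrnAl -mulr_natl avg_degreeE// mulr_suml.
apply: ler_sum => u _; rewrite mulr_suml; apply: ler_sum => v _.
by rewrite expr2 mulrC.
Qed.

Lemma count_eig_clique (K : {set G}) : (0 < #|K|)%N -> {in K &, forall u v, u != v -> adj u v} ->
  (1 <= count_eig (#|K|%:R - 1))%N.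
Proof.
move=> K0 clK; apply: (@count_ge_fun _ _ 1 (fun _ v => (v \in K)%:R)) => [a H i|a /=].
  case/card_gt0P: K0 => v vK; move: (H v); rewrite big_ord1 vK mulr1 => <-.
  by congr (a _); rewrite ord1 [RHS]ord1.
have E : \sum_v (v \in K)%:R = #|K|%:R :> R.
  by rewrite -sum1_card natr_sum [RHS]big_mkcond; apply: eq_bigr => v _; case: (v \in K).
have -> : \sum_v (\sum_(i < 1) a i * (v \in K)%:R) ^+ 2 = a ord0 ^+ 2 * #|K|%:R.
  rewrite -E mulr_sumr; apply: eq_bigr => v _.
  by rewrite big_ord1; case: (v \in K); rewrite ?mulr1 ?mulr0 ?expr0n.
rewrite mulrCA -E !mulr_sumr; apply: ler_sum => u _.
case: (boolP (u \in K)) => uK; last first.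
  by rewrite !mulr0 big1// => v _; rewrite big_ord1 mulr0 !mul0r.
rewrite mulr1 E (_ : _ - 1 = \sum_v ((v \in K)%:R - (v == u)%:R)).
  rewrite mulr_sumr; apply: ler_sum => v _; rewrite !big_ord1 mulr1.
  case: (eqVneq v u) => [->|vu]; first by rewrite uK adj_irrefl subrr !mulr0.
  case: (boolP (v \in K)) => vK; last by rewrite subrr !mulr0 mul0r.
  by rewrite clK// ?(eq_sym u) // subr0 !mulr1 expr2.
by rewrite sumrB E (bigD1 u)//= eqxx big1 ?addr0// => v /negPf ->.
Qed.

Lemma sum_spectrum_adjmx : \sum_(x <- sp) x = 0.
Proof. by rewrite sum_spectrum ?adjmx_sym// mxtrace_adjmx. Qed.

Lemma sum_sqr_spectrum_adjmx : (0 < n)%N -> \sum_(x <- sp) x ^+ 2 = n%:R * d.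
Proof. by move=> n0; rewrite sum_sqr_spectrum ?adjmx_sym// mxtrace_sqr_adjmx. Qed.

Lemma prod_nonzero_spectrum_adjmx : 1 <= \prod_(x <- sp | x != 0) `|x|.
Proof.
have := @prod_nonzero_spectrum R _ (adjmx int G).
by rewrite -(adjmx_intr R G); apply; exact: adjmx_sym.
Qed.

(** This is AM-GM for the nonzero absolute values, whose product is at least 1; it settles the case
    [d <= 1] of the theorem. *)
Lemma energy_ge_count : (count nz sp)%:R <= energy R G.
Proof.
pose t := seq.filter nz sp.
have t0 : all nz t by exact: filter_all.
have Et : \sum_(x <- t) `|x| = energy R G.
  rewrite big_filter /energy [RHS](bigID nz)/= [X in _ + X]big1 ?addr0// => x.
  by rewrite negbK => /eqP ->; rewrite normr0.
have [z z0 [_ H]] := pool_exp (ltr01 : 0 < 1 :> R) t0.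
move: H; rewrite expr1n mul1r divr1 Et size_filter => H.
have P := prod_nonzero_spectrum_adjmx; rewrite -big_filter -/t in P.
rewrite -subr_ge0 -ler_expR expR0 -(ler_pM2r (_ : 0 < 1 + z)); last by lra.
rewrite mul1r; apply: le_trans H; apply: le_trans (expR_ge1Dx z) _.
by rewrite ler_peMl ?expR_ge0.
Qed.

Lemma energy_two_positive (c : R) : (5 <= n)%N -> 1 < d -> 0 < c -> (2 <= count_eig c)%N ->
  (~~ (3 <= count_eig (0 : R))%N -> 0 \notin sp -> (2 <= count_eig (1 : R))%N \/
    exists2 D : R, D <= \prod_(x <- sp) `|x| & 3 <= D \/ 2 <= D /\ (n <= 6)%N) ->
  (count nz sp)%:R + d - 1 <= energy R G.
Proof.
move=> n5 d1 c0 cc alt; have n0 : (0 < n)%N by apply: leq_trans n5.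
have dl := sorted_count_nth (sorted_spectrum _) (count_eig_avg_degree n0).
have cp := sorted_count_nth (sorted_spectrum _) cc.
have := sum_spectrum_adjmx; have := sum_sqr_spectrum_adjmx n0.
have := prod_nonzero_spectrum_adjmx; have := size_spectrum (adjmx_sym R G).
have srt := sorted_spectrum A; move: alt; rewrite /energy /count_eig.
move: srt dl cp; case: sp => [|l [|p1 [|p2 t]]] /=; try by move=> _ _ _ _ E; move: n5; rewrite -E.
move=> /and3P[pl p21 srt] dl cp alt sz pr sq tr.
have l0 : 0 < l by lra.
have p10 : 0 < p1 by lra.
have nzE (P : R -> R) s : P 0 = 0 -> \sum_(x <- s) P x = \sum_(x <- seq.filter nz s) P x.
  move=> P0; rewrite big_filter [LHS](bigID nz)/= [X in _ + X]big1 ?addr0// => x.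
  by rewrite negbK => /eqP ->.
rewrite !big_cons (gt_eqF l0) (gt_eqF p10) /= in tr sq pr *.
have [p20|p20] := ltP 0 p2.
  have c3 : (size (seq.filter nz t) + 3 <= n)%N by rewrite -sz addn3 !ltnS size_filter count_size.
  rewrite (gt_eqF p20) /= in pr *; rewrite (nzE Num.norm t (normr0 _)) (gtr0_norm l0) (gtr0_norm p10) (gtr0_norm p20) !addrA.
  have -> : (1 + (1 + (1 + count nz t)))%N = (size (seq.filter nz t) + 3)%N by rewrite size_filter addn3.
  apply: abs_sum_ge_two_positive c3 _ _ _; rewrite ?filter_all//.
  - by have /= <- := nzE id t erefl; rewrite -[RHS]tr !addrA.
  - by have /= <- := nzE (fun x => x ^+ 2) t (expr0n _ 2); rewrite -sq !addrA.
  by move: pr; rewrite big_filter (gtr0_norm l0) (gtr0_norm p10) (gtr0_norm p20) !mulrA.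
have tneg : all (fun e => e <= 0) (p2 :: t).
  move: srt; rewrite path_sortedE => [/andP[ts _]|]; last exact: rev_trans le_trans.
  by rewrite /= p20; apply: sub_all ts => x /= xp; apply: le_trans p20.
rewrite (gtr0_norm l0) (gtr0_norm p10) in pr *.
set s := seq.filter nz (p2 :: t).
have -> : (1 + (1 + ((p2 != 0%R) + count nz t)))%N = (size s + 2)%N.
  by rewrite size_filter addn2.
have trs : l + p1 + \sum_(x <- s) x = 0.
  by have /= <- := nzE id (p2 :: t) erefl; rewrite big_cons -[RHS]tr !addrA.
have sqs : l ^+ 2 + p1 ^+ 2 + \sum_(x <- s) x ^+ 2 = n%:R * d.
  by have /= <- := nzE (fun x => x ^+ 2) (p2 :: t) (expr0n _ 2); rewrite big_cons -sq !addrA.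
have prs : 1 <= l * p1 * \prod_(x <- s) `|x|.
  by rewrite big_filter big_cons; move: pr; case: ifP => _; rewrite !mulrA.
rewrite -[X in _ + (_ + X)](big_cons _ _ p2 t predT Num.norm) (nzE Num.norm _ (normr0 _)) -/s !addrA.
have s0 : all nz s by exact: filter_all.
have sn : (size s + 2 <= n)%N by rewrite -sz addn2 !ltnS size_filter (leq_trans (count_size _ _)).
(* A strict inequality means that 0 is an eigenvalue. *)
have [s2|s2] := ltnP (size s + 2) n; first exact: abs_sum_ge_singular s2 trs sqs prs.
have sE : s = p2 :: t.
  apply/all_filterP; rewrite all_count eqn_leq count_size -size_filter -/s.
  by move: s2; rewrite -sz addn2 !ltnS.
have sneg : all (fun e => e < 0) s.
  by apply/allP => x xs; rewrite lt_neqAle (allP s0 _ xs); apply: (allP tneg); rewrite -sE.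
have p2n : p2 < 0 by have := allP sneg p2; rewrite sE inE eqxx; apply.
have cneg (e : R) : 0 <= e -> count (fun x => (e <= x)%R) t = 0%N.
  move=> e0; apply/eqP; rewrite -leqn0 leqNgt -has_count; apply/hasPn => x xt.
  rewrite -ltNge; apply: lt_le_trans e0; apply: (allP sneg).
  by rewrite sE inE xt orbT.
(* All eigenvalues other than [l] and [p1] are now negative, so both premises of [alt] hold. *)
case: alt.
- by rewrite cneg// ltW// ltW// leNgt p2n.
- by rewrite 2!in_cons (lt_eqF l0) (lt_eqF p10) /= -sE; apply/negP => /(allP s0); rewrite ?eqxx.
- rewrite cneg// [1 <= p2]leNgt (lt_trans p2n)// => cc1.
  have p1' : 1 <= p1 by move: cc1; case: (1 <= l); case: (1 <= p1).
  apply: abs_sum_ge_lambda2 n5 trs sqs prs => //.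
  by apply/eqP; rewrite eqn_leq sn.
move=> [D DP HD]; rewrite 2!big_cons (gtr0_norm l0) (gtr0_norm p10) mulrA -sE in DP.
have {}HD : 3 <= D \/ 2 <= D /\ (size s <= 4)%N.
  case: HD => [|[D2 n6]]; [exact: or_introl | apply: or_intror; split => //].
  by have := leq_trans sn n6; rewrite addn2 !ltnS.
exact: abs_sum_ge_det sn trs sqs DP HD.
Qed.

Definition has_pattern := exists a b c e : G, [|| is_2K2 a b c e, is_P4 a b c e | is_paw a b c e].

Lemma pattern_count_eig : has_pattern -> exists2 c : R, 0 < c & (2 <= count_eig c)%N.
Proof.
case=> a [b [c [e]]] /or3P[H|H|H].
- by exists 1 => //; exact: two_K2_count_eig H.
- by exists (1 / 2); [lra | exact: P4_count_eig H].
- by exists (1 / 10); [lra | exact: paw_count_eig H].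
Qed.

(** Otherwise [uw] and [vz] are edges with [v] adjacent to neither [u] nor [w]: according to how
    many of [u] and [w] are adjacent to [z], the four vertices induce a 2K2, a P4 or a paw. *)
Lemma nonadj_trans (u v w z : G) : ~ has_pattern -> adj v z -> ~~ adj u v -> ~~ adj v w -> ~~ adj u w.
Proof.
move=> np vz uv vw; apply/negP => uw; apply: np.
have [zu|zu] := boolP (adj z u); have [zw|zw] := boolP (adj z w).
- exists v, z, u, w; apply/or3P/Or33.
  by rewrite /is_paw vz zu zw uw vw adj_sym uv.
- exists w, u, z, v; apply/or3P/Or32.
  by rewrite /is_P4 (adj_sym w u) uw (adj_sym u z) zu (adj_sym z v) vz (adj_sym w z) zw uv (adj_sym w v).
- exists u, w, z, v; apply/or3P/Or32.
  by rewrite /is_P4 uw (adj_sym w z) zw (adj_sym z v) vz (adj_sym u z) zu (adj_sym w v) vw uv.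
exists u, w, v, z; apply/or3P/Or31.
by rewrite /is_2K2 uw vz uv (adj_sym u z) zu (adj_sym w v) vw (adj_sym w z).
Qed.

(** Extend an edge to a maximal clique [K]. Each non-isolated vertex has a non-neighbour in [K]
    (itself if it lies in [K]), and by [nonadj_trans] the two have equal rows; so the rows of [K]
    span the row space. *)
Lemma complete_multipartite_clique : (exists u v : G, adj u v) -> ~ has_pattern ->
  exists K : {set G}, [/\ (0 < #|K|)%N, {in K &, forall u v, u != v -> adj u v} &
    (\rank A <= #|K|)%N].
Proof.
move=> [u0 [v0 uv0]] np.
pose clique (K : {set G}) := [forall u in K, forall v in K, (u != v) ==> adj u v].
have cliqueP (K : {set G}) : reflect {in K &, forall u v, u != v -> adj u v} (clique K).
  apply: (iffP idP) => [/forall_inP H u v uK vK|H].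
    by have /forall_inP/(_ v vK)/implyP := H u uK.
  by apply/forall_inP => u uK; apply/forall_inP => v vK; apply/implyP; exact: H.
have cl0 : clique [set u0; v0].
  apply/cliqueP => u v; rewrite !inE => /orP[]/eqP -> /orP[]/eqP ->; rewrite ?eqxx// => _.
  by rewrite adj_sym.
have [K /maxsetP[clK maxK] sK] := maxset_exists cl0; exists K.
have u0K : u0 \in K by apply: (fintype.subsetP sK); rewrite !inE eqxx.
have v0K : v0 \in K by apply: (fintype.subsetP sK); rewrite !inE eqxx orbT.
split; [by apply/card_gt0P; exists u0 | exact/cliqueP | ].
have nbr u : u \in K -> exists z, adj u z.
  move=> uK; case: (eqVneq u u0) => [->|uu0]; first by exists v0.
  by exists u0; have /cliqueP := clK; apply.
pose B : 'M[R]_(#|K|, n) := \matrix_(j, i) (adj (enum_val j) (enum_val i))%:R.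
apply: leq_trans (mxrankS _) (rank_leq_row B); apply/row_subP => i.
set v := enum_val i : G.
have [/existsP[z vz]|/existsPn isol] := boolP [exists z, adj v z]; last first.
  rewrite (_ : row i A = 0) ?sub0mx//; apply/rowP => j.
  by rewrite !mxE -/v (negPf (isol _)).
have [u uK nuv] : exists2 u, u \in K & ~~ adj u v.
  have [vK|vK] := boolP (v \in K); first by exists v; rewrite ?adj_irrefl.
  have /cliqueP ncl : ~~ clique (v |: K).
    by apply: contra vK => /maxK <-; rewrite ?finset.subsetUr// finset.setU11.
  case: (boolP [exists u in K, ~~ adj u v]) => [/exists_inP[u]|]; first by exists u.
  rewrite negb_exists => /forallP H; case: ncl => x y.
  have Hv u : u \in K -> adj u v by move=> uK; have := H u; rewrite uK negbK.
  rewrite !inE => /orP[/eqP->|xK] /orP[/eqP->|yK]; rewrite ?eqxx//.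
  - by rewrite adj_sym Hv.
  - by rewrite Hv.
  - by have /cliqueP := clK; apply.
have [z' uz] := nbr u uK.
have E w : adj v w = adj u w.
  apply/idP/idP; apply: contraTT => H.
    by apply: (nonadj_trans np uz _ H); rewrite adj_sym.
  exact: (nonadj_trans np vz nuv H).
have {1}-> : row i A = row (enum_rank_in uK u) B.
  by apply/rowP => j; rewrite !mxE -/v E enum_rankK_in.
exact: row_sub.
Qed.

(* As the trace is 0, the energy is twice the sum of the positive eigenvalues. *)
Lemma energy_ge_twice (l : R) : l \in sp -> 2 * l <= energy R G.
Proof.
move=> ls; have E : energy R G = \sum_(x <- sp) (`|x| + x).
  by rewrite big_split /= sum_spectrum_adjmx addr0.
have P (x : R) : 0 <= `|x| + x by have := ler_norm (- x); rewrite normrN; lra.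
rewrite E (big_rem l)//=; have : 0 <= \sum_(x <- rem l sp) (`|x| + x) by apply: sumr_ge0.
by have := ler_norm l; lra.
Qed.

End Energy.

Theorem theorem1p1 (R : realType) (G : sgraph) (hn : (5 <= #|G|)%N) :
  energy R G >= (\rank (adjmx R G))%:R + avg_degree R G - 1.
Proof.
have n0 : (0 < #|G|)%N by apply: leq_trans hn.
have rk : (\rank (adjmx R G))%:R <= (count (fun e => e != 0) (spectrum (adjmx R G)))%:R :> R.
  by rewrite ler_nat; apply: rank_le_count_spectrum; exact: adjmx_sym.
(* Here [r + d - 1 <= r]. The other case provides both the hypothesis [1 < d] of the pooling lemmas
   and, below, an edge. *)
have [d1|d1] := lerP (avg_degree R G) 1.
  by have := energy_ge_count R G; lra.
have [pat|np] := pselect (has_pattern G).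
  have [c c0 cc] := pattern_count_eig R pat.
  have := energy_two_positive hn d1 c0 cc; rewrite -/(count_eig _ _) => H.
  suff : (count (fun e => e != 0) (spectrum (adjmx R G)))%:R + avg_degree R G - 1 <= energy R G by lra.
  by apply: H => cnt s0; exact: det_alternative.
have [|K [K0 clK rkK]] := @complete_multipartite_clique R G _ np.
  apply: contrapT => ne; move: d1; rewrite -(ltr_pM2l (_ : 0 < #|G|%:R :> R)) ?ltr0n// avg_degreeE//.
  rewrite big1 ?mulr1 ?ltNge ?ler0n// => u _; apply: big1 => v _.
  by case: (boolP (adj u v)) => // uv; case: ne; exists u, v.
have dl := sorted_count_nth (sorted_spectrum _) (count_eig_avg_degree R n0).
have kl := sorted_count_nth (sorted_spectrum _) (count_eig_clique R K0 clK).
have l2 : 2 * (spectrum (adjmx R G))`_0 <= energy R G.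
  by apply: energy_ge_twice; rewrite mem_nth// size_spectrum ?adjmx_sym.
have : (\rank (adjmx R G))%:R <= #|K|%:R :> R by rewrite ler_nat.
by lra.
Qed.
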